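(* Let $d\ge2$ be an integer. There exist $n_0=n_0(d)$ and a constant $C=C(d)>0$, depending only on $d$, such that the following holds for all $n>n_0$. Let $G$ be a $d$-regular graph such that $$|G|=n\quad\text{and}\quad 1-\lambda\ge n^{-2/3},$$ where $1-\lambda$ is the spectral gap of $G$. Let $\{A_t\}_{t\ge0}$ be a $G$-Cylinder-DLA process and, for $m\in\mathbb N$, let $T_m=\min\{t\ge0:A_t\cap G_m\ne\emptyset\}$ be the time the cluster first reaches layer $m$. Then for all $m$, $$\mathbf E[T_m]>C\,m\,n^{1/20}.$$
   Context: Graphs $G$ are finite, simple and connected; $|G|$ is the number of vertices. $\mathbb N=\{0,1,2,\dots\}$. Spectral gap: for a $d$-regular graph $G$ with adjacency matrix $B$, let $P=\frac1dB$ be the transition matrix, with (real) eigenvalues $1=\lambda_1\ge\lambda_2\ge\dots\ge\lambda_{|G|}$. Put $\lambda=\max_{i>1}|\lambda_i|$ (the ''second eigenvalue''); the spectral gap is $1-\lambda$. Cylinder: $G\times\mathbb N$ has vertex set $V(G)\times\mathbb N$, with $(u,m)\sim(v,k)$ iff either $m=k$ and $u\sim v$, or $|m-k|=1$ and $u=v$. The $i$-th layer is $G_i=V(G)\times\{i\}$. For a set $A$ of vertices of $G\times\mathbb N$, $\partial A$ is the set of vertices not in $A$ that are adjacent to some vertex of $A$. $G$-Cylinder-DLA process: a random increasing sequence $(A_t)_{t\ge 0}$ of vertex sets with $A_0=G_0$. Given $A_0,\dots,A_t$, put $M(t)=\min\{i\in\mathbb N: G_i\cap A_t=\emptyset\}$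 and let $(g_{t+1}(r),\zeta_{t+1}(r))_{r\ge0}$ be a simple random walk on $G\times\mathbb N$ (each step goes to a uniformly random neighbour) with $g_{t+1}(0)$ uniform on $V(G)$ and $\zeta_{t+1}(0)=M(t)$. Let $\kappa(t+1)=\min\{r\ge0:(g_{t+1}(r),\zeta_{t+1}(r))\in\partial A_t\}$ (a.s. finite) and $A_{t+1}=A_t\cup\{(g_{t+1}(\kappa(t+1)),\zeta_{t+1}(\kappa(t+1)))\}$.
   Formalization: The bound is stated for all m ≥ 2 rather than all m: it fails for m = 0, since T_0 = 0, and for m = 1, since T_1 = 1 always while C n^{1/20} is unbounded as n grows. *)

(* Defs.v *)
From HB Require Import structures.
From mathcomp Require Export all_boot all_order all_algebra.
From mathcomp Require Export finmap.
From mathcomp Require Export all_classical all_reals all_analysis.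

Set Implicit Arguments.
Unset Strict Implicit.
Unset Printing Implicit Defensive.

Import Order.TTheory GRing.Theory Num.Theory.
Import numFieldNormedType.Exports.

Local Open Scope classical_set_scope.
Local Open Scope ring_scope.

Definition simple_graph (V : finType) (e : rel V) : Prop :=
  symmetric e /\ irreflexive e.

Definition connected_graph (V : finType) (e : rel V) : Prop :=
  forall u v : V, connect e u v.

Definition regular_graph (d : nat) (V : finType) (e : rel V) : Prop :=
  forall u : V, #|[set v | e u v]%SET| = d.

Definition adjacency_matrix (R : realType) (V : finType) (e : rel V) :
    'M[R]_#|V| :=
  \matrix_(i, j) (e (enum_val i) (enum_val j))%:R.

Definition transition_matrix (R : realType) (d : nat) (V : finType)
    (e : rel V) : 'M[R]_#|V| :=
  (d%:R)^-1 *: adjacency_matrix R e.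

(* [s] lists the eigenvalues of [M], with algebraic multiplicity and in
   nonincreasing order; there is exactly one such [s] when [M] is symmetric. *)
Definition spectrum (R : realType) (n : nat) (M : 'M[R]_n) (s : seq R) : Prop :=
  sorted >=%R s /\ char_poly M = \prod_(a <- s) ('X - a%:P).

(* The absolute values are nonnegative, so the base value 0 is harmless. *)
Definition second_eigenvalue (R : realType) (s : seq R) : R :=
  \big[Num.max/0]_(a <- behead s) `|a|.

Definition spectral_gap (R : realType) (s : seq R) : R :=
  1 - second_eigenvalue s.

Definition cyl_adj (V : finType) (e : rel V) : rel (V * nat) :=
  fun x y => ((x.2 == y.2) && e x.1 y.1)
          || (((x.2 == y.2.+1) || (y.2 == x.2.+1)) && (x.1 == y.1)).

Definition layer (V : finType) (i : nat) : set (V * nat) :=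
  [set x | x.2 = i].

Definition cyl_boundary (V : finType) (e : rel V) (A : set (V * nat)) :
    set (V * nat) :=
  [set y | ~ A y /\ exists2 x, A x & cyl_adj e x y].

Definition cyl_degree (V : finType) (e : rel V) (x : V * nat) : nat :=
  #|` fset_set [set y | cyl_adj e x y]|.

Lemma finite_cyl_nbhd (V : finType) (e : rel V) (x : V * nat) :
  finite_set [set y | cyl_adj e x y].
Proof.
apply: (@sub_finite_set _ _ ([set: V] `*` `I_(x.2.+2))).
  move=> [v k] /= h; split => //=; move: h; rewrite /cyl_adj /=.
  by case/orP=> [/andP[/eqP -> _]|/andP[/orP[/eqP ->|/eqP ->] _]] //;
    rewrite leqW // ltnS leqW.
exact: finite_setX.
Qed.

Definition srw_step (R : realType) (V : finType) (e : rel V)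
    (x y : V * nat) : R :=
  if cyl_adj e x y then ((cyl_degree e x)%:R)^-1 else 0.

(* Probability that the simple random walk on the cylinder, started from a
   uniform vertex of layer [i], has [x 0, ..., x k] as its first positions. *)
Definition srw_path_prob (R : realType) (V : finType) (e : rel V) (i : nat)
    (k : nat) (x : nat -> V * nat) : R :=
  (if (x 0%N).2 == i then (#|V|%:R)^-1 else 0) *
  \prod_(r < k) srw_step R e (x r) (x r.+1).

Definition is_min (S : set nat) (i : nat) : Prop :=
  S i /\ forall j, S j -> (i <= j)%N.

(* [W t.+1 r] is the position after [r] steps of the walk that adds a vertex to
   [A t] ([W 0] is not used).  The third condition says that, conditionally on
   [A 0, ..., A t], this walk is a simple random walk started from a uniform
   vertex of the first layer that does not meet [A t].  In the last one, [r] is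
   the first hitting time of the boundary of [A t]; nothing is required on the
   null event on which the boundary is never hit. *)
Definition cylinder_DLA (R : realType) (disp : measure_display)
    (Omega : measurableType disp) (P : probability Omega R)
    (V : finType) (e : rel V) (A : nat -> Omega -> set (V * nat)) : Prop :=
  exists W : nat -> nat -> Omega -> V * nat,
  [/\ (forall t x, measurable [set w | A t w x]) /\
      (forall t r x, measurable [set w | W t r w = x]),
      forall w, A 0%N w = layer 0,
      forall (t : nat) (B : nat -> set (V * nat)) (M : nat),
        is_min [set i | layer i `&` B t = set0] M ->
        forall (k : nat) (x : nat -> V * nat),
        P [set w | (forall s, (s <= t)%N -> A s w = B s) /\
                   (forall r, (r <= k)%N -> W t.+1 r w = x r)] =
        (P [set w | forall s, (s <= t)%N -> A s w = B s] *
         (srw_path_prob R e M k x)%:E)%E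
    & forall (t : nat) (w : Omega) (r : nat),
        is_min [set r' | cyl_boundary e (A t w) (W t.+1 r' w)] r ->
        A t.+1 w = A t w `|` [set W t.+1 r w]].

(* Equal to +oo if layer [m] is never reached. *)
Definition reach_time (R : realType) (Omega : Type) (V : finType)
    (A : nat -> Omega -> set (V * nat)) (m : nat) (w : Omega) : \bar R :=
  ereal_inf [set (t%:R)%:E | t in [set t | A t w `&` layer m !=set0]].

(* Main.v *)
Require Import Defs.
From mathcomp Require Import complex spectral sesquilinear.
From mathcomp Require Import zify ring lra.
Import Order.TTheory GRing.Theory Num.Theory.
Import numFieldNormedType.Exports.
Local Open Scope classical_set_scope.
Local Open Scope ring_scope.

(** The cluster is slow to climb because no vertex of its boundary is likely
    to be the next one added, and this in turn is an energy estimate.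

    Fix the current cluster, let [M] be the first layer it misses, let [x] be
    a boundary vertex and put [D = d + 2].  The probability that the next
    walk stops at [x] is at most the mean over layer [M] of the Green function
    [F] with pole [x] of the walk killed on the cluster ([hit_le]).  The walk
    is killed with probability at least [1 / D] right after each visit to [x],
    so [F <= D], and the Dirichlet energy of [F] is at most [D ^ 2]
    ([green_energy_le]).  On the other hand every layer [i < M] contains a
    vertex of the cluster, where [F] vanishes; by the Poincaré inequality the
    horizontal energy of this layer is at least the spectral gap times the
    square of the mean [phi_i] of [F] on it.  By Cauchy-Schwarz the vertical
    energy is at least [n] times the sum of the [(phi_(i+1) - phi_i) ^ 2].
    As [phi_0 = 0], these bounds keep [phi_M] small ([green_layer_mean_le]):
    for [n = s ^ 20] and a gap of at least [n ^ (-2/3) >= s ^ (-14)],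
    [phi_M ^ 2 <= 3 * D ^ 2 / s ^ 3].  For [M <= 2] the vertical energy alone
    gives [phi_M ^ 2 <= 2 * D ^ 2 / n].

    Let [p] bound the probability of every boundary vertex.  Weigh a vertex of
    height [h] by [theta ^ h].  The boundary weighs at most [theta * D] times
    as much as the cluster, so one step multiplies the expected weight of the
    cluster by at most [1 + p * theta * D], and height [m] is reached within
    [k] steps with probability at most [theta ^ (-m) * n * (1 + p * theta *
    D) ^ k] ([reach_prob_le_mass]).  With [theta = e], [k = m * s] and
    [p = 1 / (2 * e * D * s)], which is a bound for [phi_M] if [s] is large,
    this is at most [n * exp (- m / 2)], which is small if [m > s ^ 3].  For
    smaller [m] it is enough to wait for height two: a vertex of height at
    least two can only be attached to one of the vertices added before, so [k]
    steps reach it with probability at most [D * p * k ^ 2], where [p] is now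
    of order [n ^ (-1/2)] ([reach_prob_le_low]); take [k] at most [s ^ 4].

    All probabilities of walk events are estimated by comparing them with
    functions on the cylinder that decrease on average along the walk
    ([walk_event_le]).  The walk does meet the boundary almost surely, because
    a bounded function of the height that is harmonic and vanishes at height
    zero is zero ([height_survival_cvg0]). *)

Set Implicit Arguments.
Unset Strict Implicit.
Unset Printing Implicit Defensive.

(** * A quadratic form bound for symmetric matrices *)

Section SymmetricMatrix.
Local Open Scope sesquilinear_scope.

(** In an orthonormal eigenbasis the quadratic form is a sum of eigenvalues
    times squared coordinates; the eigenvalues above [lam] do not contribute
    because [g] is orthogonal to their eigenvectors.  The basis is taken over
    the complex numbers, where the spectral theorem applies; an eigenvalue of
    [M] is real, so the real and imaginary parts of a complex eigenvector are
    themselves eigenvectors of [M]. *)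
Lemma symmetric_quadratic_bound (R : realType) n (M : 'M[R]_n) (s : seq R)
    (lam : R) (g : 'rV[R]_n) :
  M^T = M -> char_poly M = \prod_(a <- s) ('X - a%:P) ->
  (forall (a : R) (v : 'rV_n), a \in s -> lam < a -> v *m M = a *: v ->
     v *m g^T = 0) ->
  (g *m M *m g^T) 0 0 <= lam * (g *m g^T) 0 0.
Proof.
move=> symM specM orthg.
pose C : numClosedFieldType := R[i]%C; pose f : {rmorphism R -> C} := real_complex R.
have ReD : {morph (@complex.Re R) : x y / x + y} by case=> ? ? [].
have ImD : {morph (@complex.Im R) : x y / x + y} by case=> ? ? [].
pose M' : 'M[C]_n := map_mx f M; pose g' : 'rV[C]_n := map_mx f g.
have realf x : f x \is Num.real by apply/complex_realP; exists x.
have hermM : M' \is hermsymmx.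
  apply/realsym_hermsym.
    by apply/is_hermitianmxP; rewrite expr0 scale1r map_mx_id // /M' map_trmx symM.
  by apply/mxOverP => i j; rewrite mxE.
have /orthomx_spectralP := hermitian_normalmx hermM.
have := spectral_unitarymx M'; have := hermitian_spectral_diag_real hermM.
set U := spectralmx M'; set D := spectral_diag M' => realD unitU eqM.
rewrite (invmx_unitary unitU) in eqM.
have UU : U^t* *m U = 1%:M by rewrite -(invmx_unitary unitU) mulVmx // unitarymx_unit.
have UU' : U *m U^t* = 1%:M by apply/unitarymxP.
pose h := g' *m U^t*.
have realg : g'^T = g'^t*.
  by apply/matrixP => i j; rewrite !mxE (conj_Creal (realf _)).
have hh : h^t* = U *m g'^T.
  by rewrite /h trmx_mul map_mxM -realg trmxCK.
have E1 : f ((g *m M *m g^T) 0 0) = \sum_i D 0 i * `|h 0 i| ^+ 2.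
  have -> : f ((g *m M *m g^T) 0 0) = (h *m diag_mx D *m h^t*) 0 0.
    rewrite hh /h -!mulmxA [X in (g' *m X)]mulmxA [X in (g' *m X)]mulmxA -eqM.
    by rewrite map_trmx -!map_mxM [in RHS]mxE mulmxA.
  rewrite mul_mx_diag mxE; apply: eq_bigr => i _.
  by rewrite !mxE -mulrA mulrCA -normCK mulrC.
have E2 : f ((g *m g^T) 0 0) = \sum_i `|h 0 i| ^+ 2.
  have -> : f ((g *m g^T) 0 0) = (h *m h^t*) 0 0.
    by rewrite hh /h -mulmxA (mulmxA _ U) UU mul1mx map_trmx -map_mxM [in RHS]mxE.
  rewrite mxE; apply: eq_bigr => i _.
  by rewrite !mxE -normCK.
rewrite -lecR -/f rmorphM /= E1 E2 mulr_sumr; apply: ler_sum => i _.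
have /complex_realP [a Da] : D 0 i \is Num.real by apply/mxOverP.
rewrite Da; have [al|la] := leP a lam.
  by rewrite ler_wpM2r ?exprn_ge0 // lecR.
suff -> : h 0 i = 0 by rewrite normr0 expr0n !mulr0.
pose w := row i U.
have eqw : w *m M' = (f a) *: w.
  by rewrite -row_mul eqM 2!mulmxA UU' mul1mx mul_diag_mx; apply/rowP => j; rewrite !mxE Da.
have as_ : a \in s.
  have : eigenvalue M' (f a).
    apply/eigenvalueP; exists w => //; apply/eqP => w0.
    have := congr1 (fun A : 'M[C]_n => A i i) UU'.
    rewrite !mxE eqxx big1 => [/eqP|j _]; first by rewrite eq_sym oner_eq0.
    by have := congr1 (fun A : 'rV[C]_n => A 0 j) w0; rewrite !mxE => ->; rewrite mul0r.
  rewrite eigenvalue_root_char -map_char_poly specM rmorph_prod /=.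
  under eq_bigr do rewrite rmorphB /= map_polyX map_polyC /=.
  rewrite -(big_map f xpredT (fun z => 'X - z%:P)) root_prod_XsubC.
  by move=> /mapP [b bs] /complexI ->.
have sumRe (c : 'I_n -> C) : complex.Re (\sum_j c j) = \sum_j complex.Re (c j).
  by apply: (big_morph _ ReD).
have sumIm (c : 'I_n -> C) : complex.Im (\sum_j c j) = \sum_j complex.Im (c j).
  by apply: (big_morph _ ImD).
have Refr (x : C) y : complex.Re (x * f y) = complex.Re x * y.
  by case: x => x1 x2 /=; rewrite mulr0 subr0.
have Imfr (x : C) y : complex.Im (x * f y) = complex.Im x * y.
  by case: x => x1 x2 /=; rewrite mulr0 add0r.
have orth1 : \sum_j complex.Re (w 0 j) * g 0 j = 0.
  have : (\row_j complex.Re (w 0 j)) *m M = a *: (\row_j complex.Re (w 0 j)).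
    apply/rowP => j; have := congr1 (fun A : 'rV[C]_n => complex.Re (A 0 j)) eqw.
    rewrite !mxE sumRe mulrC Refr mulrC => <-.
    by apply: eq_bigr => k _; rewrite !mxE Refr.
  move=> /(orthg _ _ as_ la) /(congr1 (fun A : 'M[R]_1 => A 0 0)).
  by rewrite !mxE => H; rewrite -[RHS]H; apply: eq_bigr => j _; rewrite !mxE.
have orth2 : \sum_j complex.Im (w 0 j) * g 0 j = 0.
  have : (\row_j complex.Im (w 0 j)) *m M = a *: (\row_j complex.Im (w 0 j)).
    apply/rowP => j; have := congr1 (fun A : 'rV[C]_n => complex.Im (A 0 j)) eqw.
    rewrite !mxE sumIm mulrC Imfr mulrC => <-.
    by apply: eq_bigr => k _; rewrite !mxE Imfr.
  move=> /(orthg _ _ as_ la) /(congr1 (fun A : 'M[R]_1 => A 0 0)).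
  by rewrite !mxE => H; rewrite -[RHS]H; apply: eq_bigr => j _; rewrite !mxE.
have wg : \sum_j w 0 j * f (g 0 j) = 0.
  apply/eqP; rewrite eq_complex sumRe sumIm.
  under eq_bigr do rewrite Refr; rewrite orth1.
  by under eq_bigr do rewrite Imfr; rewrite orth2 !eqxx.
have hi : (h 0 i)^* = (h^t*) i 0 by rewrite [RHS]mxE [in RHS]mxE.
apply/eqP; rewrite -conjC_eq0 hi hh mxE; apply/eqP; rewrite -[RHS]wg.
by apply: eq_bigr => j _; rewrite !mxE.
Qed.

End SymmetricMatrix.

(** * The Poincaré inequality of a regular graph *)

Definition vertex_mean (R : realType) (V : finType) (f : V -> R) : R :=
  (\sum_v f v) / #|V|%:R.

Definition nbr_sum (R : realType) (V : finType) (e : rel V) (f : V -> R)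
    (u : V) : R :=
  \sum_(v | e u v) f v.

Section Graph.
Variables (R : realType) (d : nat) (V : finType) (e : rel V).
Hypothesis simpleG : simple_graph e.
Hypothesis regG : regular_graph d e.
Implicit Types f g : V -> R.

Let symG : symmetric e. Proof. by case: simpleG. Qed.

Lemma nbr_sum_cst (c : R) u : nbr_sum e (fun=> c) u = d%:R * c.
Proof.
rewrite /nbr_sum sumr_const mulr_natl; congr (_ *+ _).
by rewrite -(regG u) cardsE.
Qed.

Lemma nbr_sum_sym f g : \sum_u f u * nbr_sum e g u = \sum_u g u * nbr_sum e f u.
Proof.
rewrite /nbr_sum; under eq_bigr do rewrite mulr_sumr big_mkcond.
under [RHS]eq_bigr do rewrite mulr_sumr big_mkcond.
rewrite exchange_big; apply: eq_bigr => u _; apply: eq_bigr => v _.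
by rewrite symG mulrC.
Qed.

Lemma sum_nbr_sum f : \sum_u nbr_sum e f u = d%:R * \sum_u f u.
Proof.
have := nbr_sum_sym (fun=> 1) f.
under eq_bigr do rewrite mul1r; move=> ->.
by under eq_bigr do rewrite nbr_sum_cst mulr1 mulrC; rewrite mulr_sumr.
Qed.

Lemma dirichlet_form f :
  \sum_u \sum_(v | e u v) (f u - f v) ^+ 2 =
  2 * \sum_u f u * (d%:R * f u - nbr_sum e f u).
Proof.
have -> : \sum_u \sum_(v | e u v) (f u - f v) ^+ 2 =
    \sum_u (d%:R * f u ^+ 2 - 2 * (f u * nbr_sum e f u)) +
    \sum_u nbr_sum e (fun v => f v ^+ 2) u.
  rewrite -big_split; apply: eq_bigr => u _ /=.
  rewrite -(nbr_sum_cst _ u) /nbr_sum !mulr_sumr -sumrB -big_split /=.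
  by apply: eq_bigr => v _; ring.
rewrite sum_nbr_sum !mulr_sumr -big_split; apply: eq_bigr => u _ /=; ring.
Qed.

(** The Dirichlet form of a harmonic function vanishes, so the function takes
    equal values at the two ends of each edge. *)
Lemma harmonic_const f : connected_graph e ->
  (forall u, nbr_sum e f u = d%:R * f u) -> forall u v, f u = f v.
Proof.
move=> conG harm.
have := dirichlet_form f.
rewrite [X in 2 * X]big1 ?mulr0 => [|u _]; last by rewrite harm subrr mulr0.
move=> /eqP; rewrite psumr_eq0 => [/allP energy0|u _]; last first.
  by apply: sumr_ge0 => v _; exact: sqr_ge0.
have step u v : e u v -> f u = f v.
  move=> euv; have := energy0 u (mem_index_enum _) => /=.
  rewrite psumr_eq0 => [/allP|w _]; last exact: sqr_ge0.
  by move=> /(_ v (mem_index_enum _)); rewrite euv /= sqrf_eq0 subr_eq0 => /eqP.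
move=> u v; have /connectP [p] := conG u v.
by elim: p u => [u _ -> //|w p IH u /= /andP[/step -> /IH]].
Qed.

Lemma sum_sub_mean f : (0 < #|V|)%N -> \sum_v (f v - vertex_mean f) = 0.
Proof.
move=> V0; rewrite sumrB sumr_const -[#|xpredT|]/#|V| -mulr_natr divfK ?subrr //.
by rewrite pnatr_eq0 -lt0n.
Qed.

(** The quadratic form bound applies to [f] minus its mean with [lam] the
    second eigenvalue.  An eigenvalue above [lam] cannot occur in the tail of
    [lambda], so it is the head of this list; as [lam < 1], the eigenvalue [1]
    is the head as well.  By connectedness the eigenvectors of [1] are
    constant, hence orthogonal to functions of mean zero. *)
Lemma poincare (lambda : seq R) f : (0 < d)%N -> (0 < #|V|)%N ->
  connected_graph e -> spectrum (transition_matrix R d e) lambda ->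
  0 < spectral_gap lambda ->
  d%:R * spectral_gap lambda * \sum_u (f u - vertex_mean f) ^+ 2 <=
  \sum_u f u * (d%:R * f u - nbr_sum e f u).
Proof.
move=> d0 V0 conG [sortl charl] gap0.
have dR0 : (d%:R : R) != 0 by rewrite pnatr_eq0 -lt0n.
set c := vertex_mean f; pose g u := f u - c.
have nbrg u : nbr_sum e g u = nbr_sum e f u - d%:R * c.
  by rewrite -(nbr_sum_cst c u) /nbr_sum -sumrB.
have -> : \sum_u f u * (d%:R * f u - nbr_sum e f u) =
          \sum_u g u * (d%:R * g u - nbr_sum e g u).
  have -> : \sum_u f u * (d%:R * f u - nbr_sum e f u) =
      \sum_u (g u * (d%:R * g u - nbr_sum e g u) +
              c * (d%:R * f u - nbr_sum e f u)).
    by apply: eq_bigr => u _; rewrite nbrg /g; ring.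
  rewrite big_split /= -mulr_sumr sumrB -mulr_sumr sum_nbr_sum subrr mulr0.
  by rewrite addr0.
set M := transition_matrix R d e in charl.
pose h : 'rV[R]_#|V| := \row_j g (enum_val j).
have sumE (F : V -> R) : \sum_u F u = \sum_(j < #|V|) F (enum_val j).
  by rewrite -(big_enum_val _ (A := V)).
have mulM (v : 'rV[R]_#|V|) j :
    (v *m M) 0 j = d%:R^-1 * nbr_sum e (fun u => v 0 (enum_rank u)) (enum_val j).
  rewrite mxE /nbr_sum mulr_sumr [RHS]big_mkcond [RHS]sumE; apply: eq_bigr => i _.
  rewrite !mxE enum_valK symG; case: (e _ _); rewrite ?mulr1 ?mulr0 //.
  by rewrite mulrC.
have symM : M^T = M by apply/matrixP => i j; rewrite !mxE symG.
have := symmetric_quadratic_bound (lam := second_eigenvalue lambda) (g := h)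
  symM charl.
have -> : (h *m h^T) 0 0 = \sum_u g u ^+ 2.
  by rewrite mxE sumE; apply: eq_bigr => j _; rewrite !mxE expr2.
have -> : (h *m M *m h^T) 0 0 = d%:R^-1 * \sum_u g u * nbr_sum e g u.
  rewrite mxE sumE mulr_sumr; apply: eq_bigr => j _.
  rewrite mulM !mxE [LHS]mulrC mulrCA; congr (_ * (_ * _)).
  by apply: eq_bigr => v _; rewrite mxE enum_rankK.
move=> quad.
suff /quad : forall (a : R) (v : 'rV_#|V|), a \in lambda ->
    second_eigenvalue lambda < a -> v *m M = a *: v -> v *m h^T = 0.
  rewrite ler_pdivrMl ?ltr0n // => H.
  under [leRHS]eq_bigr do rewrite mulrBr.
  rewrite sumrB lerBrDr; apply: le_trans (lerD (lexx _) H) _.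
  rewrite le_eqVlt; apply/orP; left; apply/eqP.
  under [RHS]eq_bigr do rewrite mulrCA -expr2.
  by rewrite -mulr_sumr /spectral_gap; ring.
have tail_le b : b \in behead lambda -> b <= second_eigenvalue lambda.
  move=> bl; apply: le_trans (ler_norm b) _; rewrite /second_eigenvalue.
  exact: (@Order.TotalTheory.bigmax_sup_seq _ _ _ _ _ b).
have one_in : 1 \in lambda.
  have : eigenvalue M 1.
    apply/eigenvalueP; exists (const_mx 1).
      apply/rowP => j; rewrite mulM scale1r [RHS]mxE.
      rewrite (_ : (fun u => _) = fun=> 1) ?nbr_sum_cst ?mulr1 ?mulVf //.
      by apply/funext => u; rewrite mxE.
    apply/negP => /eqP/rowP/(_ (Ordinal V0)); rewrite !mxE => /eqP.
    by rewrite oner_eq0.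
  by rewrite eigenvalue_root_char charl root_prod_XsubC.
move: gap0; rewrite /spectral_gap subr_gt0 => lt1.
move=> a v al la eigv.
have a1 : a = 1.
  case: lambda al one_in tail_le la lt1 {sortl charl quad} => // b l.
  rewrite !inE /= => al l1 H la lt1.
  have {}al : a = b by case/predU1P: al => // /H; rewrite leNgt la.
  by case/predU1P: l1 => [->|/H] //; rewrite leNgt lt1.
rewrite a1 scale1r in eigv.
have vconst : forall u w, v 0 (enum_rank u) = v 0 (enum_rank w).
  apply: (harmonic_const conG) => u.
  have := congr1 (fun A : 'rV[R]__ => A 0 (enum_rank u)) eigv.
  rewrite /= mulM enum_rankK => /(congr1 ( *%R d%:R)).
  by rewrite mulVKf.
apply/matrixP => i j; rewrite !ord1 mxE.
transitivity (\sum_u v 0 (enum_rank u) * g u).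
  by rewrite sumE; apply: eq_bigr => k _; rewrite enum_valK !mxE.
rewrite [RHS]mxE; under eq_bigr do rewrite (vconst _ (enum_val (Ordinal V0))).
by rewrite -mulr_sumr sum_sub_mean // mulr0.
Qed.

End Graph.

(** * Energy of the killed Green function *)

(** The expectation of [f] after one step of the walk from [y].  The weight
    [1 / (d + 2)] is the right one at positive heights only; the walk is always
    stopped before it comes to height zero. *)
Definition walk_op (R : realType) (d : nat) (V : finType) (e : rel V)
    (f : V * nat -> R) (y : V * nat) : R :=
  (nbr_sum e (fun v => f (v, y.2)) y.1 + f (y.1, y.2.+1) + f (y.1, y.2.-1)) /
  d.+2%:R.

(** The Green function with pole [x] of the walk killed on [A], truncated in
    time: the expected number of visits to [x] among the first [K] steps. *)
Fixpoint green (R : realType) (d : nat) (V : finType) (e : rel V)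
    (A : set (V * nat)) (x : V * nat) (K : nat) (y : V * nat) : R :=
  (y == x)%:R +
  (if K is K'.+1 then
     if `[< A y >] then 0 else walk_op d e (green R d e A x K') y
   else 0).

Lemma summation_by_parts (R : realType) (a : nat -> R) N :
  \sum_(i < N) (a i.+1 - a i) ^+ 2 =
  \sum_(i < N) a i.+1 * (2 * a i.+1 - a i.+2 - a i) +
  (a 0%N * (a 0%N - a 1%N) - a N * (a N - a N.+1)).
Proof.
elim: N => [|N IH]; first by rewrite !big_ord0 subrr addr0.
by rewrite !big_ord_recr /= IH; ring.
Qed.

(** One step is the inequality [2 * a * b <= c * a ^ 2 + b ^ 2 / c], with [b]
    the increment. *)
Lemma sqr_growth_bound (R : realType) (a : nat -> R) (c : R) N :
  0 < c -> a 0%N = 0 ->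
  a N ^+ 2 <= c * \sum_(i < N) a i ^+ 2 +
              (1 + c^-1) * \sum_(i < N) (a i.+1 - a i) ^+ 2.
Proof.
move=> c0 a0; elim: N => [|N IH].
  by rewrite !big_ord0 a0 expr0n /= !mulr0 addr0.
rewrite !big_ord_recr /= !mulrDr.
suff H : a N.+1 ^+ 2 <= a N ^+ 2 + c * a N ^+ 2 +
    (1 + c^-1) * (a N.+1 - a N) ^+ 2 by lra.
(* completing the square *)
have -> : a N.+1 ^+ 2 = a N ^+ 2 + c * a N ^+ 2 +
    (1 + c^-1) * (a N.+1 - a N) ^+ 2 - c^-1 * (c * a N - (a N.+1 - a N)) ^+ 2.
  by field; rewrite gt_eqF.
by rewrite gerBl mulr_ge0 ?sqr_ge0 // invr_ge0 ltW.
Qed.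

Lemma sumr_ord_widen_le (R : realType) (f : nat -> R) m N :
  (m <= N)%N -> (forall i, 0 <= f i) ->
  \sum_(i < m) f i <= \sum_(i < N) f i.
Proof.
move=> mN f0; rewrite -(subnKC mN) big_split_ord /= lerDl.
by apply: sumr_ge0 => i _; exact: f0.
Qed.

Section Green.
Variables (R : realType) (d : nat) (V : finType) (e : rel V).
Hypothesis simpleG : simple_graph e.
Hypothesis regG : regular_graph d e.
Hypothesis d0 : (0 < d)%N.

Local Notation D := (d.+2%:R : R).
Local Notation Q := (@walk_op R d V e).

Let D0 : 0 < D. Proof. by rewrite ltr0n. Qed.

Lemma le_walk_op f g y : (forall z, f z <= g z) -> Q f y <= Q g y.
Proof.
move=> fg; rewrite /walk_op ler_pM2r ?invr_gt0 // !lerD //.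
by apply: ler_sum => v _; exact: fg.
Qed.

Lemma walk_op_ge0 f y : (forall z, 0 <= f z) -> 0 <= Q f y.
Proof.
move=> f0; rewrite /walk_op divr_ge0 // !addr_ge0 //.
by apply: sumr_ge0 => v _.
Qed.

Lemma walk_op_cst c y : Q (fun=> c) y = c.
Proof.
rewrite /walk_op (nbr_sum_cst regG) -[d.+2]addn2 natrD -[X in X / _]addrA.
have : d%:R + 2 != 0 :> R by rewrite -(natrD _ d 2) pnatr_eq0 addn2.
by move=> ?; field.
Qed.

Variables (A : set (V * nat)) (x : V * nat).
Hypothesis A0 : layer 0 `<=` A.
Hypothesis bdx : cyl_boundary e A x.

Local Notation F := (@green R d V e A x).

Lemma green_ge0 K y : 0 <= F K y.
Proof.
elim: K y => [|K IH] y /=; first by rewrite addr0 ler0n.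
by rewrite addr_ge0 ?ler0n //; case: ifP => // _; exact: walk_op_ge0.
Qed.

Lemma green_in K y : A y -> F K y = 0.
Proof.
move=> Ay; have -> : F K y = (y == x)%:R.
  by case: K => [|K] /=; rewrite ?addr0 // asboolT // addr0.
by case: eqP => // yx; case: bdx; rewrite -yx.
Qed.

Lemma green_self K : 1 <= F K x.
Proof.
case: K => [|K] /=; rewrite eqxx lerDl //.
by case: ifP => // _; apply: walk_op_ge0; exact: green_ge0.
Qed.

Lemma green_rec K y : ~ A y -> F K.+1 y = (y == x)%:R + Q (F K) y.
Proof. by move=> nAy /=; rewrite asboolF. Qed.

Lemma green_le_succ K y : F K y <= F K.+1 y.
Proof.
elim: K y => [|K IH] y.
  rewrite /= lerD2l; case: ifP => // _.
  by apply: walk_op_ge0 => z; exact: green_ge0 0%N z.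
have [Ay|nAy] := pselect (A y); first by rewrite !green_in.
by rewrite !(green_rec _ nAy) lerD2l; exact: le_walk_op.
Qed.

Lemma green_support K u j : (x.2 + K < j)%N -> F K (u, j) = 0.
Proof.
have neq v i : (x.2 < i)%N -> ((v, i) == x) = false.
  by move=> xi; apply/eqP => vx; move: xi; rewrite -vx /= ltnn.
elim: K u j => [|K IH] u j xj /=; rewrite neq ?add0r; [by []|lia| |lia].
case: ifP => // _; rewrite /walk_op /nbr_sum /= !IH ?big1 ?addr0 ?mul0r //.
- by move=> v _; rewrite IH //; lia.
- lia.
- lia.
Qed.

(** Each visit to [x] is followed by a step into [A] with probability at least
    [1 / D], so the number of visits is at most geometric.  The proof uses the
    maximum principle instead of the Markov property. *)
Lemma green_le K y : F K y <= D.
Proof.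
have [nAx [z Az zx]] := bdx.
pose G y : R := if `[< A y >] then 0 else D.
have GD y' : G y' <= D by rewrite /G; case: ifP => // _; exact: ltW.
have QGx : Q G x <= D - 1.
  have Gz : G z = 0 by rewrite /G asboolT.
  rewrite /walk_op ler_pdivrMr //.
  have nbrG f : (forall v, f v <= D) -> nbr_sum e f x.1 <= d%:R * D.
    by move=> fD; rewrite -(nbr_sum_cst regG D x.1); apply: ler_sum.
  have DE : D = d%:R + 2 by rewrite -natrD addn2.
  case: z Az zx Gz => [v j] Az; rewrite /cyl_adj /=.
  case/orP=> [/andP[/eqP-> evx] Gz|/andP[/orP[]/eqP jx /eqP->] Gz].
  - have : nbr_sum e (fun v => G (v, x.2)) x.1 <= d%:R * D - D.
      have exv : e x.1 v by case: simpleG => sym _; rewrite sym.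
      rewrite -(nbr_sum_cst regG D x.1) /nbr_sum (bigD1 v) //= Gz add0r.
      rewrite [X in _ <= X - _](bigD1 v) //= [leRHS]addrC addKr.
      by apply: ler_sum => w _.
    have := GD (x.1, x.2.+1); have := GD (x.1, x.2.-1); lra.
  - rewrite jx in Gz; rewrite Gz.
    have := nbrG (fun v => G (v, x.2)) (fun v => GD _).
    have := GD (x.1, x.2.-1); lra.
  - rewrite jx /= Gz.
    have := nbrG (fun v => G (v, j.+1)) (fun v => GD _).
    have := GD (x.1, j.+2). lra.
(* [G] is a supersolution: off [A] it is at least the indicator of [x] plus
   its average, since the average at [x] misses the term of [z] *)
suff FG : F K y <= G y by exact: le_trans (GD y).
elim: K y => [|K IH] y.
  rewrite /= addr0 /G; case: asboolP => [Ay|_].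
    by case: eqP => // yx; case: nAx; rewrite -yx.
  by case: (y == x); rewrite ?ler1n // ltW.
have [Ay|nAy] := pselect (A y); first by rewrite green_in // /G asboolT.
rewrite green_rec // /G asboolF //.
case: eqP => [->|_].
  rewrite mulr1n; have := le_trans (le_walk_op x IH) QGx; lra.
rewrite add0r -(walk_op_cst D y); apply: le_walk_op => w.
exact: le_trans (GD w).
Qed.

(* [D] times the Laplacian of the Green function at layer [i.+1] *)
Let lap K v i : R :=
  D * F K (v, i.+1) - nbr_sum e (fun w => F K (w, i.+1)) v
  - F K (v, i.+2) - F K (v, i).

(** The Laplacian of [F] is at most the indicator of [x] off [A], because [F]
    increases with the time horizon, and [F] vanishes on [A].  So the sum is
    at most [D * F x], and [F x <= D]. *)
Lemma green_energy_le K N :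
  \sum_(i < N) \sum_v F K (v, i.+1) * lap K v i <= D ^+ 2.
Proof.
have lapx v i : F K (v, i.+1) * lap K v i <= ((v, i.+1) == x)%:R * D ^+ 2.
  have [Ay|nAy] := pselect (A (v, i.+1)).
    by rewrite green_in // mul0r mulr_ge0 ?sqr_ge0.
  have lapE : lap K v i <= ((v, i.+1) == x)%:R * D.
    have := green_le_succ K (v, i.+1).
    rewrite green_rec // /walk_op /lap /= => H.
    have -> : D * F K (v, i.+1) - nbr_sum e (fun w => F K (w, i.+1)) v -
       F K (v, i.+2) - F K (v, i) = D * (F K (v, i.+1) -
       (nbr_sum e (fun w => F K (w, i.+1)) v + F K (v, i.+2) + F K (v, i)) / D).
      by field; rewrite gt_eqF.
    rewrite mulrC ler_pM2r //; by rewrite lerBlDr.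
  apply: le_trans (ler_wpM2l (green_ge0 _ _) lapE) _.
  rewrite mulrCA ler_wpM2l // expr2 ler_wpM2r ?green_le //; exact: ltW.
apply: le_trans (_ : \sum_(i < N) \sum_v ((v, i.+1) == x)%:R * D ^+ 2 <= _).
  by apply: ler_sum => i _; apply: ler_sum => v _.
have sum1 (i : nat) : \sum_v ((v, i.+1) == x)%:R * D ^+ 2 =
    (i.+1 == x.2)%:R * D ^+ 2.
  rewrite (bigD1 x.1) //= big1 => [|v /negPf vx]; last first.
    by rewrite -pair_eqE /= vx mul0r.
  by rewrite addr0 -pair_eqE /= eqxx.
under eq_bigr do rewrite sum1; rewrite -mulr_suml ler_piMl ?sqr_ge0 //.
rewrite -natr_sum (ler_nat R _ 1).
case: (ltnP x.2.-1 N) => [xN|Nx].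
  rewrite (bigD1 (Ordinal xN)) //= big1 ?addn0 ?leq_b1 // => i.
  by rewrite -val_eqE /= => /eqP ix; apply/eqP; rewrite eqb0; lia.
rewrite big1 // => i _; apply/eqP; rewrite eqb0; have := ltn_ord i; lia.
Qed.

Lemma sqr_mean_le (f : V -> R) : (0 < #|V|)%N ->
  #|V|%:R * vertex_mean f ^+ 2 <= \sum_v f v ^+ 2.
Proof.
move=> V0; have VR : (#|V|%:R : R) != 0 by rewrite pnatr_eq0 -lt0n.
have : 0 <= \sum_v (f v - vertex_mean f) ^+ 2.
  by apply: sumr_ge0 => v _; exact: sqr_ge0.
have -> : \sum_v (f v - vertex_mean f) ^+ 2 =
   \sum_v f v ^+ 2 - 2 * vertex_mean f * \sum_v f v + #|V|%:R * vertex_mean f ^+ 2.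
  have -> : #|V|%:R * vertex_mean f ^+ 2 = \sum_(v : V) vertex_mean f ^+ 2.
    by rewrite sumr_const mulr_natl.
  rewrite mulr_sumr -sumrB -big_split /=.
  by apply: eq_bigr => v _; ring.
have -> : \sum_v f v = #|V|%:R * vertex_mean f.
  by rewrite /vertex_mean mulrC divfK.
by move=> ?; lra.
Qed.

Variables (lambda : seq R) (M : nat).
Hypothesis V0 : (0 < #|V|)%N.
Hypothesis conG : connected_graph e.
Hypothesis specG : spectrum (transition_matrix R d e) lambda.
Hypothesis gap0 : 0 < spectral_gap lambda.
Hypothesis layersA : forall i, (i < M)%N -> exists v, A (v, i).

Let phi K i : R := vertex_mean (fun v => F K (v, i)).

Let phi0 K : phi K 0%N = 0.
Proof.
rewrite /phi /vertex_mean big1 ?mul0r // => v _.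
by rewrite green_in //; exact: A0.
Qed.

(** A layer below [M] contains a vertex where [F] is zero, and there alone the
    deviation from the mean already has square [phi K i ^+ 2]. *)
Lemma horizontal_energy_ge K i : (i < M)%N ->
  spectral_gap lambda * phi K i ^+ 2 <=
  \sum_v F K (v, i) * (d%:R * F K (v, i) - nbr_sum e (fun w => F K (w, i)) v).
Proof.
move=> iM; have [a Aa] := layersA iM.
have := poincare simpleG regG (fun v => F K (v, i)) d0 V0 conG specG gap0.
apply: le_trans; rewrite -/(phi K i) [X in _ <= X * _]mulrC -mulrA.
rewrite ler_wpM2l ?(ltW gap0) //.
have sq : phi K i ^+ 2 <= \sum_v (F K (v, i) - phi K i) ^+ 2.
  rewrite (bigD1 a) //= (green_in _ Aa) sub0r sqrrN lerDl.
  by apply: sumr_ge0 => v _; exact: sqr_ge0.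
apply: le_trans sq _; rewrite ler_peMl ?ler1n //.
by apply: sumr_ge0 => v _; exact: sqr_ge0.
Qed.

Lemma horizontal_energy_ge0 K i :
  0 <= \sum_v F K (v, i) * (d%:R * F K (v, i) - nbr_sum e (fun w => F K (w, i)) v).
Proof.
rewrite -(pmulr_rge0 _ (ltr0Sn R 1)) -(dirichlet_form simpleG regG).
by apply: sumr_ge0 => u _; apply: sumr_ge0 => v _; exact: sqr_ge0.
Qed.

(** The truncated Green function vanishes at layer [0] and above some layer, so
    summation by parts in the vertical direction leaves no boundary term. *)
Lemma layer_mean_energy K :
  spectral_gap lambda * \sum_(i < M) phi K i ^+ 2 +
  #|V|%:R * \sum_(i < M) (phi K i.+1 - phi K i) ^+ 2 <= D ^+ 2.
Proof.
(* beyond the support of the Green function, and above layer [M] *)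
pose N := (M + (x.2 + K).+1)%N.
apply: le_trans (green_energy_le K N).
have -> : \sum_(i < N) \sum_v F K (v, i.+1) * lap K v i =
    \sum_(i < N) \sum_v F K (v, i.+1) *
       (d%:R * F K (v, i.+1) - nbr_sum e (fun w => F K (w, i.+1)) v) +
    \sum_(i < N) \sum_v (F K (v, i.+1) - F K (v, i : nat)) ^+ 2.
  rewrite [X in _ = _ + X]exchange_big /=.
  under [X in _ = _ + X]eq_bigr => v _.
    rewrite (summation_by_parts (fun i => F K (v, i))).
    rewrite (green_in _ (A0 _)) // mul0r [F K (v, N)]green_support; last by rewrite /N; lia.
    rewrite mul0r subrr addr0; over.
  rewrite [X in _ = _ + X]exchange_big -big_split; apply: eq_bigr => i _ /=.
  rewrite -big_split; apply: eq_bigr => v _ /=.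
  have DE : D = d%:R + 2 by rewrite -natrD addn2.
  rewrite /lap DE; set S := nbr_sum _ _ _; ring.
apply: lerD.
  pose h i := \sum_v F K (v, i) * (d%:R * F K (v, i) -
      nbr_sum e (fun w => F K (w, i)) v).
  apply: le_trans (_ : \sum_(i < M) h i <= _).
    by rewrite mulr_sumr; apply: ler_sum => i _; exact: horizontal_energy_ge.
  have h0 : h 0%N = 0.
    by rewrite /h big1 // => v _; rewrite green_in ?mul0r //; exact: A0.
  have hsum m : (m <= N)%N -> \sum_(i < m) h i <= \sum_(i < N) h i.+1.
    case: m => [|m] mN.
      by rewrite big_ord0; apply: sumr_ge0 => i _; exact: horizontal_energy_ge0.
    rewrite big_ord_recl h0 add0r.
    apply: (@sumr_ord_widen_le _ (fun i => h i.+1)); first exact: ltnW.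
    by move=> i; exact: horizontal_energy_ge0.
  by apply: hsum; rewrite leq_addr.
apply: le_trans (_ : \sum_(i < M) \sum_v (F K (v, i.+1) - F K (v, i : nat)) ^+ 2 <= _).
  rewrite mulr_sumr; apply: ler_sum => i _.
  have -> : phi K i.+1 - phi K i =
      vertex_mean (fun v => F K (v, i.+1) - F K (v, i : nat)).
    by rewrite /phi /vertex_mean -mulrBl -sumrB.
  exact: sqr_mean_le.
apply: (@sumr_ord_widen_le _ (fun i => \sum_v (F K (v, i.+1) - F K (v, i)) ^+ 2)).
  by rewrite leq_addr.
by move=> i; apply: sumr_ge0 => v _; exact: sqr_ge0.
Qed.

(** The layer means start from [0] at layer [0]; a rapid climb to a large value
    costs vertical energy, and a slow one horizontal energy. *)
Lemma green_layer_mean_le K (c : R) : 0 < c ->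
  phi K M ^+ 2 <=
  D ^+ 2 * (c / spectral_gap lambda + (1 + c^-1) / #|V|%:R).
Proof.
move=> c0; have VR : 0 < #|V|%:R :> R by rewrite ltr0n.
have := layer_mean_energy K.
set X := \sum_(i < M) _; set Y := \sum_(i < M) _ => E.
have X0 : 0 <= X by apply: sumr_ge0 => i _; exact: sqr_ge0.
have Y0 : 0 <= Y by apply: sumr_ge0 => i _; exact: sqr_ge0.
apply: le_trans (sqr_growth_bound M c0 (phi0 K)) _; rewrite -/X -/Y.
have XD : X <= D ^+ 2 / spectral_gap lambda.
  rewrite ler_pdivlMr // mulrC; apply: le_trans E.
  by rewrite lerDl mulr_ge0 // ltW.
have YD : Y <= D ^+ 2 / #|V|%:R.
  rewrite ler_pdivlMr // mulrC; apply: le_trans E.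
  by rewrite lerDr mulr_ge0 // ltW.
rewrite mulrDr; apply: lerD.
  by rewrite mulrCA ler_wpM2l // ltW.
by rewrite mulrCA ler_wpM2l // addr_ge0 // invr_ge0 ltW.
Qed.

Lemma green_layer_mean_le_low K : (M <= 2)%N ->
  phi K M ^+ 2 <= 2 * D ^+ 2 / #|V|%:R.
Proof.
move=> M2; have VR : 0 < #|V|%:R :> R by rewrite ltr0n.
rewrite ler_pdivlMr // mulrC.
have := layer_mean_energy K.
set X := \sum_(i < M) _; set Y := \sum_(i < M) _ => E.
have X0 : 0 <= X by apply: sumr_ge0 => i _; exact: sqr_ge0.
have {}E : #|V|%:R * Y <= D ^+ 2.
  by apply: le_trans E; rewrite lerDr mulr_ge0 // ltW.
suff H : phi K M ^+ 2 <= 2 * Y.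
  apply: le_trans (_ : #|V|%:R * (2 * Y) <= _); first by rewrite ler_pM2l.
  by rewrite mulrCA ler_pM2l.
rewrite /Y; case: (M) M2 => [|[|[|//]]] _.
- by rewrite big_ord0 phi0 expr0n mulr0.
- rewrite big_ord1 phi0 subr0 /=; have := sqr_ge0 (phi K 1); lra.
- rewrite 2!big_ord_recl big_ord0 /= /bump /= phi0.
  have := sqr_ge0 (phi K 2 - 2 * phi K 1); nra.
Qed.

End Green.

(** * Recurrence of the height *)

(** The probability that the height of the walk, starting from [j], stays
    positive during [K] steps. *)
Fixpoint height_survival (R : realType) (d K j : nat) : R :=
  if j is j'.+1 then
    if K is K'.+1 then
      (d%:R * height_survival R d K' j + height_survival R d K' j.+1 +
       height_survival R d K' j') / d.+2%:R
    else 1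
  else 0.

Section HeightSurvival.
Variables (R : realType) (d : nat).
Local Notation s := (height_survival R d).
Local Notation D := (d.+2%:R : R).

Lemma height_survival0 K : s K 0 = 0. Proof. by case: K. Qed.

Lemma height_survivalS K j :
  s K.+1 j.+1 = (d%:R * s K j.+1 + s K j.+2 + s K j) / D.
Proof. by []. Qed.

Lemma height_survival_ge0 K j : 0 <= s K j.
Proof.
elim: K j => [|K IH] [|j] //=.
by rewrite divr_ge0 // !addr_ge0 // mulr_ge0.
Qed.

Lemma height_survival_le1 K j : s K j <= 1.
Proof.
elim: K j => [|K IH] [|j]; rewrite ?height_survival0 //.
rewrite height_survivalS ler_pdivrMr ?ltr0n // mul1r.
have -> : D = d%:R + 2 by rewrite -natrD addn2.
have : d%:R * s K j.+1 <= d%:R by rewrite ler_piMr.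
by have := IH j; have := IH j.+2; lra.
Qed.

Lemma height_survival_decr K j : s K.+1 j <= s K j.
Proof.
elim: K j => [|K IH] [|j]; rewrite ?height_survival0 //.
  exact: height_survival_le1.
rewrite [leLHS]height_survivalS [leRHS]height_survivalS ler_pM2r ?invr_gt0 ?ltr0n //.
by have := ler_wpM2l (ler0n R d) (IH j.+1); have := IH j; have := IH j.+2; lra.
Qed.

(** The limits in [K] form a harmonic function of the height that vanishes at
    [0], hence a linear one; being bounded, it is zero. *)
Lemma height_survival_cvg0 j : (fun K => s K j) @ \oo --> (0 : R).
Proof.
have cvs i : cvgn (fun K => s K i).
  apply: nonincreasing_is_cvgn.
    by apply/nonincreasing_seqP => K; exact: height_survival_decr.
  by exists 0 => _ [K _ <-]; exact: height_survival_ge0.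
pose l i := limn (fun K => s K i).
have l0 : l 0%N = 0.
  by apply/cvg_lim => //; under eq_fun do rewrite height_survival0; exact: cvg_cst.
have ls i : l i.+2 = 2 * l i.+1 - l i.
  have E : D * l i.+1 = d%:R * l i.+1 + l i.+2 + l i.
    have H1 : (fun K => s K.+1 i.+1) @ \oo --> l i.+1.
      by rewrite (cvg_shiftS (fun K => s K i.+1)); exact: cvs.
    have H2 : (fun K => (d%:R * s K i.+1 + s K i.+2 + s K i) / D) @ \oo -->
        (d%:R * l i.+1 + l i.+2 + l i) / D.
      apply: cvgMr_tmp; apply: cvgD; last exact: cvs.
      by apply: cvgD; [apply: cvgMl_tmp; exact: cvs|exact: cvs].
    have H := cvg_unique (@Rhausdorff R) H1 H2.
    by rewrite [in LHS]H mulrC divfK ?pnatr_eq0.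
  have DE : D = d%:R + 2 by rewrite -natrD addn2.
  by rewrite DE in E; lra.
have lin i : l i = i%:R * l 1%N /\ l i.+1 = i.+1%:R * l 1%N.
  elim: i => [|i [IH1 IH2]]; first by rewrite l0 mul0r mul1r.
  by split => //; rewrite ls IH1 IH2 -!natr1; ring.
have lle i : l i <= 1.
  apply: limr_le; first exact: cvs.
  by near=> K; exact: height_survival_le1.
have lge i : 0 <= l i.
  apply: limr_ge; first exact: cvs.
  by near=> K; exact: height_survival_ge0.
have l1 : l 1%N = 0.
  apply/eqP; rewrite eq_le lge andbT leNgt; apply/negP => l1.
  have := lle (Num.truncn (l 1%N)^-1).+1.
  rewrite (lin _).2 leNgt => /negP; apply.
  rewrite -ltr_pdivrMr // mul1r.
  exact: truncnS_gt.
have -> : (0 : R) = l j by rewrite (lin j).1 l1 mulr0.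
exact: cvs.
Unshelve. all: by end_near.
Qed.

End HeightSurvival.

(** Vertical moves do not depend on the position in the base graph. *)
Lemma walk_op_height_survival (R : realType) (d : nat) (V : finType)
    (e : rel V) K (y : V * nat) :
  regular_graph d e -> (0 < y.2)%N ->
  walk_op d e (fun z => height_survival R d K z.2) y =
  height_survival R d K.+1 y.2.
Proof.
case: y => u [|j] //= regG _.
by rewrite /walk_op /= (nbr_sum_cst regG).
Qed.

(** * Steps of the walk on the cylinder, outer probability *)

Section Step.
Variables (R : realType) (d : nat) (V : finType) (e : rel V).
Hypothesis regG : regular_graph d e.

(** At height zero the list also contains [y] itself, which does no harm in
    upper bounds. *)
Definition cyl_nbrs (y : V * nat) : seq (V * nat) :=
  (y.1, y.2.+1) :: (y.1, y.2.-1) :: [seq (v, y.2) | v <- enum (e y.1)].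

Lemma mem_cyl_nbrs y z : (0 < y.2)%N -> (z \in cyl_nbrs y) = cyl_adj e y z.
Proof.
case: y z => u [|j] // [v k] _; rewrite !inE /= /cyl_adj /= -!pair_eqE /=.
have -> : ((v, k) \in [seq (v0, j.+1) | v0 <- enum (e u)]) = (j.+1 == k) && e u v.
  apply/mapP/andP => [[w]|[/eqP <- euv]].
    by rewrite mem_enum => euw [-> ->].
  by exists v => //; rewrite mem_enum.
rewrite (eq_sym v u) orbA orbC; congr orb.
rewrite andbC (andbC _ (k == j)) -andb_orl; congr andb.
by rewrite orbC (eq_sym k j).
Qed.

Lemma uniq_cyl_nbrs y : (0 < y.2)%N -> uniq (cyl_nbrs y).
Proof.
case: y => u [|j] // _; rewrite /= !inE -pair_eqE /= eqxx /=.
rewrite map_inj_uniq ?enum_uniq ?andbT; last by move=> v w [].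
rewrite negb_or -andbA; apply/and3P; split; first by lia.
  by apply/negP => /mapP [w _ [_]]; lia.
by apply/negP => /mapP [w _ [_]]; lia.
Qed.

Lemma cyl_degree_pos y : (0 < y.2)%N -> cyl_degree e y = d.+2.
Proof.
move=> y0; rewrite /cyl_degree.
have -> : fset_set [set z | cyl_adj e y z] = [fset z in cyl_nbrs y]%fset.
  apply/fsetP => z; rewrite in_fset_set; last exact: finite_cyl_nbhd.
  by rewrite in_fset /= mem_cyl_nbrs //; apply/idP/idP; rewrite inE.
rewrite card_fseq undup_id ?uniq_cyl_nbrs //= size_map -cardE.
by rewrite -(regG y.1) cardsE.
Qed.

Lemma sum_srw_step (f : V * nat -> R) y : (0 < y.2)%N ->
  \sum_(z <- cyl_nbrs y) srw_step R e y z * f z = walk_op d e f y.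
Proof.
move=> y0.
transitivity (\sum_(z <- cyl_nbrs y) d.+2%:R^-1 * f z).
  apply: eq_big_seq => z; rewrite mem_cyl_nbrs // /srw_step => ->.
  by rewrite cyl_degree_pos.
rewrite -mulr_sumr mulrC /walk_op /cyl_nbrs !big_cons big_map big_enum /=.
by congr (_ / _); rewrite /nbr_sum; ring.
Qed.

End Step.

Section OuterProbability.
Context (R : realType) (disp : measure_display) (Omega : measurableType disp).
Variable P : probability Omega R.
Local Open Scope ereal_scope.
Local Notation Ps := (mu_ext P).

(** Outer probability is monotone and countably subadditive on all sets, so
    that events of the walk can be estimated without showing that they are
    measurable. *)
Lemma outer_probability_split (T : countType) (X : Omega -> T) (zs : seq T)
    (E : set Omega) :
  (forall z, z \notin zs -> Ps (E `&` [set w | X w = z]) = 0) ->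
  Ps E <= \sum_(z <- zs) Ps (E `&` [set w | X w = z]).
Proof.
move=> null.
have fin : Ps (E `&` [set w | X w \in zs]) <=
    \sum_(z <- zs) Ps (E `&` [set w | X w = z]).
  elim: zs {null} => [|z zs IH].
    rewrite big_nil (_ : _ `&` _ = set0) ?outer_measure0 //.
    by apply/seteqP; split => // w [].
  rewrite big_cons; apply: le_trans (leeD (le_refl _) IH).
  apply: le_trans (outer_measureU2 _ _ _); apply: le_outer_measure.
  by move=> w [Ew]; rewrite /= inE => /orP[/eqP|] Xw; [left|right].
apply: le_trans fin; rewrite -[leRHS]adde0.
pose N n := if choice.unpickle n is Some z then
  (if z \in zs then set0 else E `&` [set w | X w = z]) else set0 : set Omega.
have N0 n : Ps (N n) = 0.
  rewrite /N; case: (choice.unpickle n) => [z|]; last exact: outer_measure0.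
  by case: ifPn => [_|/null //]; exact: outer_measure0.
have : Ps (\bigcup_n N n) <= 0.
  apply: le_trans (outer_measure_sigma_subadditive _ N) _.
  by rewrite eseries0 // => n _ _; exact: N0.
move=> /(leeD (le_refl (Ps (E `&` [set w | X w \in zs])))).
apply: le_trans; apply: le_trans (outer_measureU2 _ _ _).
apply: le_outer_measure => w Ew.
have [Xz|Xz] := boolP (X w \in zs); [by left|right].
by exists (choice.pickle (X w)) => //; rewrite /N choice.pickleK (negPf Xz).
Qed.

End OuterProbability.

(** * Supersolutions and events of the walk *)

Section Walk.
Context (R : realType) (disp : measure_display) (Omega : measurableType disp).
Variables (P : probability Omega R) (d : nat) (V : finType) (e : rel V).
Hypothesis regG : regular_graph d e.
Local Notation Ps := (mu_ext P).
Variables (H : set Omega) (W : nat -> Omega -> V * nat) (M : nat).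
Hypothesis mH : measurable H.
Hypothesis mW : forall r x, measurable [set w | W r w = x].
Hypothesis walkW : forall k (x : nat -> V * nat),
  P [set w | H w /\ (forall r, (r <= k)%N -> W r w = x r)] =
  (P H * (srw_path_prob R e M k x)%:E)%E.

Let h : R := fine (P H).

Let PH : P H = h%:E.
Proof. by rewrite /h fineK // fin_num_measure. Qed.

Let h0 : 0 <= h.
Proof. by rewrite /h fine_ge0. Qed.

Let prefix k (x : nat -> V * nat) :=
  [set w | H w /\ (forall r, (r <= k)%N -> W r w = x r)].

Let mprefix k x : measurable (prefix k x).
Proof.
have -> : prefix k x = H `&` \bigcap_(r in [set r | (r <= k)%N]) [set w | W r w = x r].
  by apply/seteqP; split => w [Hw Ww]; split.
by apply: measurableI => //; apply: bigcap_measurable => [|r _]; [by exists 0%N|exact: mW].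
Qed.

Let Ps_prefix k x : Ps (prefix k x) = (h * srw_path_prob R e M k x)%:E.
Proof. by rewrite measurable_mu_extE // EFinM -PH; exact: walkW. Qed.

Let path_prob_ge0 k x : 0 <= srw_path_prob R e M k x.
Proof.
rewrite /srw_path_prob mulr_ge0 //; first by case: ifP.
by apply: prodr_ge0 => r _; rewrite /srw_step; case: ifP.
Qed.

Variables (u : nat -> V * nat -> R) (I : V * nat -> Prop).
Variable Ev : nat -> (nat -> V * nat) -> Prop.
Hypothesis I_pos : forall y, I y -> (0 < y.2)%N.
Hypothesis u_ge0 : forall j y, 0 <= u j y.
Hypothesis Ev0 : forall tau, I (tau 0%N) -> Ev 0 tau -> 1 <= u 0%N (tau 0%N).
Hypothesis EvS : forall j tau, I (tau 0%N) -> Ev j.+1 tau ->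
  u j.+1 (tau 0%N) < 1 ->
  [/\ walk_op d e (u j) (tau 0%N) <= u j.+1 (tau 0%N),
      forall z, cyl_adj e (tau 0%N) z -> I z &
      Ev j (fun i => tau i.+1)].

Let Evk j k x := [set w | prefix k x w /\ Ev j (fun i => W (k + i)%N w)].

(** The Markov property, by induction on the time horizon [j]: the event
    either has the trivial bound [1 <= u j], or it forces an event of horizon
    [j - 1] after the next step, and then [u] is averaged over that step.  The
    invariant [I] records that the walk has not entered the cluster, so that
    its height is positive. *)
Lemma walk_prefix_event_le j k x : I (x k) ->
  (Ps (Evk j k x) <= (h * srw_path_prob R e M k x * u j (x k))%:E)%E.
Proof.
have easy j' k' x' : 1 <= u j' (x' k') ->
    (Ps (Evk j' k' x') <= (h * srw_path_prob R e M k' x' * u j' (x' k'))%:E)%E.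
  move=> u1; apply: (@le_trans _ _ (Ps (prefix k' x'))).
    by apply: le_outer_measure => w [].
  by rewrite Ps_prefix lee_fin ler_peMr // mulr_ge0.
have empty j' k' x' : Evk j' k' x' = set0 ->
    (Ps (Evk j' k' x') <= (h * srw_path_prob R e M k' x' * u j' (x' k'))%:E)%E.
  by move=> ->; rewrite outer_measure0 lee_fin mulr_ge0 // mulr_ge0.
have start j' k' x' w : Evk j' k' x' w -> W (k' + 0)%N w = x' k'.
  by move=> [[_ Ww] _]; rewrite addn0 Ww.
elim: j k x => [|j IH] k x Ix.
  have [[w Ew]|E0] := pselect (exists w, Evk 0 k x w); last first.
    by apply: empty; apply/seteqP; split => // w Ew; apply: E0; exists w.
  have Wk := start _ _ _ _ Ew; apply: easy; rewrite -Wk.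
  by apply: (Ev0 (tau := fun i => W (k + i)%N w)); [rewrite Wk|exact: Ew.2].
have [[w Ew]|E0] := pselect (exists w, Evk j.+1 k x w); last first.
  by apply: empty; apply/seteqP; split => // w Ew; apply: E0; exists w.
have [u1|u1] := leP 1 (u j.+1 (x k)); first exact: easy.
have EvSx w' : Evk j.+1 k x w' -> [/\ walk_op d e (u j) (x k) <= u j.+1 (x k),
    forall z, cyl_adj e (x k) z -> I z & Ev j (fun i => W (k.+1 + i)%N w')].
  move=> Ew'; have Wk := start _ _ _ _ Ew'.
  have := @EvS j (fun i => W (k + i)%N w'); rewrite Wk => /(_ Ix Ew'.2 u1) [? ? E].
  by split => //; under eq_fun do rewrite addSnnS.
have [Qu adjI _] := EvSx _ Ew.
pose x' z r := if (r <= k)%N then x r else z.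
have pref' z w' : prefix k x w' -> W k.+1 w' = z -> prefix k.+1 (x' z) w'.
  move=> [Hw Ww] Wz; split => // r; rewrite /x'.
  case: ifP => [rk _|rk rk1]; first exact: Ww.
  by rewrite -Wz; congr W; lia.
have prob' z : srw_path_prob R e M k.+1 (x' z) =
    srw_path_prob R e M k x * srw_step R e (x k) z.
  rewrite /srw_path_prob big_ord_recr /= mulrA /x' leqnn ltnn; congr (_ * _ * _).
  by apply: eq_bigr => r _; rewrite (ltnW (ltn_ord r)) ltn_ord.
have split_sum := @outer_probability_split _ _ _ P _ (W k.+1) (cyl_nbrs e (x k))
  (Evk j.+1 k x).
apply: le_trans (split_sum _) _ => {split_sum} [z nz|].
  apply/eqP; rewrite eq_le outer_measure_ge0 andbT.
  apply: (@le_trans _ _ (Ps (prefix k.+1 (x' z)))).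
    by apply: le_outer_measure => w' [[Hw' _] Wz]; exact: pref'.
  rewrite Ps_prefix prob' /srw_step -mem_cyl_nbrs ?(negPf nz) ?mulr0 //.
  exact: I_pos.
apply: (@le_trans _ _ (\sum_(z <- cyl_nbrs e (x k))
    (h * srw_path_prob R e M k x * (srw_step R e (x k) z * u j z))%:E)%E).
  rewrite !big_seq; apply: lee_sum => z; rewrite mem_cyl_nbrs; last exact: I_pos.
  move=> adjz; have := IH k.+1 (x' z); rewrite /x' ltnn prob'.
  move=> /(_ (adjI _ adjz)).
  rewrite !mulrA; apply: le_trans; apply: le_outer_measure => w' [Ew' Wz].
  split; first by apply: pref' => //; exact: Ew'.1.
  by have [] := EvSx _ Ew'.
rewrite sumEFin lee_fin -mulr_sumr (sum_srw_step regG) //; last exact: I_pos.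
by rewrite ler_wpM2l // mulr_ge0.
Qed.

Hypothesis V0 : (0 < #|V|)%N.
Hypothesis I_start : forall v, I (v, M).

Lemma walk_event_le j :
  (Ps [set w | H w /\ Ev j (fun i => W i w)] <=
   (h * vertex_mean (fun v => u j (v, M)))%:E)%E.
Proof.
have VR : (#|V|%:R : R) != 0 by rewrite pnatr_eq0 -lt0n.
set E := [set w | _].
have split_sum := @outer_probability_split _ _ _ P _ (W 0%N)
  [seq (v, M) | v <- enum V] E.
apply: le_trans (split_sum _) _ => {split_sum} [z nz|].
  apply/eqP; rewrite eq_le outer_measure_ge0 andbT.
  apply: (@le_trans _ _ (Ps (prefix 0 (fun=> z)))).
    apply: le_outer_measure => w' [[Hw' _] Wz]; split => // r.
    by rewrite leqn0 => /eqP ->.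
  rewrite Ps_prefix /srw_path_prob big_ord0 mulr1.
  case: eqP => [zM|_]; last by rewrite mulr0.
  case/negP: nz; apply/mapP; exists z.1; first by rewrite mem_enum.
  by rewrite -zM; case: (z).
rewrite big_map big_enum /=.
apply: (@le_trans _ _ (\sum_v (h * (#|V|%:R^-1 * u j (v, M)))%:E)%E).
  apply: lee_sum => v _; have := @walk_prefix_event_le j 0 (fun=> (v, M)) (I_start v).
  rewrite /srw_path_prob eqxx big_ord0 mulr1 mulrA.
  apply: le_trans; apply: le_outer_measure => w' [[Hw' Ew'] Wz].
  split; last by [].
  by split => // r; rewrite leqn0 => /eqP ->.
rewrite sumEFin lee_fin -mulr_sumr -mulr_sumr /vertex_mean.
by rewrite [X in _ <= _ * X]mulrC.
Qed.
End Walk.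

(** * Boundaries of finite clusters *)

Lemma ex_is_min (S : set nat) : S !=set0 -> exists i, is_min S i.
Proof.
move=> [n Sn]; pose p := [pred i | `[< S i >]].
have ex : exists i, p i by exists n; apply/asboolP.
exists (ex_minn ex); case: ex_minnP => i /asboolP Si mini; split => // j Sj.
by apply: mini; apply/asboolP.
Qed.

Lemma cyl_adj_sym (V : finType) (e : rel V) : simple_graph e ->
  symmetric (cyl_adj e).
Proof.
move=> [sym _] [u i] [v j]; rewrite /cyl_adj /= sym (eq_sym i) (eq_sym u).
by congr (_ || (_ && _)); rewrite orbC.
Qed.

Definition cluster (V : finType) (S : {fset V * nat}) : set (V * nat) :=
  layer 0 `|` [set x | x \in S].

Section Cluster.
Variables (V : finType) (e : rel V).
Implicit Types S : {fset V * nat}.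

Lemma ex_empty_layer S : exists M,
  is_min [set i | layer i `&` cluster S = set0] M.
Proof.
apply: ex_is_min; exists (\max_(x <- enum_fset S) x.2).+1.
apply/seteqP; split => // y [/= yM] [|/= yS]; first by rewrite /layer /= yM.
have := leq_bigmax_seq (F := fun x : V * nat => x.2) _ yS isT.
by rewrite yM ltnn.
Qed.

Definition bd_points S : seq (V * nat) :=
  undup [seq x <- [seq (v, 1%N) | v <- enum V] ++
                  flatten [seq cyl_nbrs e z | z <- enum_fset S] |
         `[< cyl_boundary e (cluster S) x >]].

Lemma mem_bd_points S x :
  (x \in bd_points S) <-> cyl_boundary e (cluster S) x.
Proof.
rewrite mem_undup mem_filter; split; first by case/andP => /asboolP.
move=> bdx; apply/andP; split; first exact/asboolP.
have [nx [z zS zx]] := bdx; rewrite mem_cat.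
have x0 : (0 < x.2)%N by rewrite lt0n; apply/eqP => x0; apply: nx; left.
case: (posnP z.2) => z0.
  apply/orP; left; apply/mapP; exists x.1; first by rewrite mem_enum.
  move: zx; rewrite /cyl_adj z0; case: (x) x0 => u [|[|j]] //= _.
apply/orP; right; apply/flattenP; exists (cyl_nbrs e z).
  by apply/mapP; exists z => //; case: zS => //= z0'; rewrite z0' in z0.
by rewrite mem_cyl_nbrs.
Qed.

Lemma cluster_add S x : cluster (x |` S)%fset = cluster S `|` [set x].
Proof.
rewrite /cluster -setUA; congr (_ `|` _); apply/seteqP; split => y /=.
  by rewrite in_fset1U => /orP[/eqP|]; [right|left].
by rewrite in_fset1U => -[->|->]; rewrite ?orbT ?eqxx.
Qed.

End Cluster.

Lemma sum_disjoint_le (R : realType) disp (Omega : measurableType disp)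
    (P : probability Omega R) (T : eqType) (F : T -> set Omega) (s : seq T)
    (H : set Omega) :
  uniq s -> measurable H -> (forall x, measurable (F x)) ->
  (forall x, x \in s -> F x `<=` H) ->
  (forall x y, x \in s -> y \in s -> x != y -> F x `&` F y = set0) ->
  (\sum_(x <- s) P (F x) <= P H)%E.
Proof.
move=> + + mF; elim: s H => [|x s IH] H /=.
  by move=> _ mH _ _; rewrite big_nil measure_ge0.
move=> /andP[xs us] mH FH disj; rewrite big_cons.
have -> : P H = (P (F x) + P (H `\` F x))%E.
  rewrite -measureU //; last 2 first.
  - exact: measurableD.
  - by apply/seteqP; split => // w [? []].
  by rewrite setDUK //; apply: FH; rewrite mem_head.
apply: leeD2l; apply: IH => //.
- exact: measurableD.
- move=> y ys w Fyw; split; first by apply: (FH y) => //; rewrite inE ys orbT.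
  move=> Fxw; have : (F x `&` F y) w by [].
  rewrite disj //; first by rewrite mem_head.
    by rewrite inE ys orbT.
  by apply: contraNneq xs => ->.
- by move=> y z ys zs; apply: disj; rewrite inE ?ys ?zs orbT.
Qed.

(** * One step of the aggregation, and induction over the steps *)

Section DLA.
Context (R : realType) (disp : measure_display) (Omega : measurableType disp).
Variables (P : probability Omega R) (d : nat) (V : finType) (e : rel V).
Hypothesis simpleG : simple_graph e.
Hypothesis regG : regular_graph d e.
Hypothesis V0 : (0 < #|V|)%N.
Local Notation Ps := (mu_ext P).
Variable A : nat -> Omega -> set (V * nat).
Hypothesis DLA : cylinder_DLA P e A.

Definition history (B : nat -> set (V * nat)) (t : nat) : set Omega :=
  [set w | forall s, (s <= t)%N -> A s w = B s].

Definition extend_history (B : nat -> set (V * nat)) t x s :=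
  if (s <= t)%N then B s else B t `|` [set x].

Lemma measurable_history B t : measurable (history B t).
Proof.
have [_ [[mA _] _ _ _]] := DLA.
have -> : history B t = \bigcap_(s in [set s | (s <= t)%N])
    \bigcap_(n : nat) (if choice.unpickle n is Some x then
       (if `[< B s x >] then [set w | A s w x] else ~` [set w | A s w x]) else setT).
  apply/seteqP; split => w Hw.
    move=> s /= st n _; case: (choice.unpickle n) => [x|] //.
    by rewrite -(Hw _ st); case: asboolP.
  move=> s st; apply/seteqP; split => x.
    move=> Ax; have := Hw s st (choice.pickle x) I; rewrite choice.pickleK.
    by case: asboolP.
  move=> Bx; have := Hw s st (choice.pickle x) I; rewrite choice.pickleK.
  by rewrite asboolT.
apply: bigcap_measurable => [|s _]; first by exists 0%N.
apply: bigcap_measurable => [|n _]; first by exists 0%N.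
case: (choice.unpickle n) => [x|]; last exact: measurableT.
by case: ifP => _; [exact: mA|apply: measurableC; exact: mA].
Qed.

Section Step.
Variables (B : nat -> set (V * nat)) (t : nat) (S : {fset V * nat}) (M : nat).
Hypothesis BS : B t = cluster S.
Hypothesis minM : is_min [set i | layer i `&` cluster S = set0] M.

Let bd := cyl_boundary e (cluster S).

Let startM v : ~ cluster S (v, M).
Proof. by move=> Sv; have [/seteqP [H _] _] := minM; apply: (H (v, M)). Qed.

Let pos_out y : ~ cluster S y -> (0 < y.2)%N.
Proof. by move=> nSy; rewrite lt0n; apply/eqP => y0; apply: nSy; left. Qed.

Let adj_out y z : ~ cluster S y -> ~ bd y -> cyl_adj e y z -> ~ cluster S z.
Proof.
move=> nSy nby yz Sz; apply: nby; split => //; exists z => //.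
by rewrite (cyl_adj_sym simpleG).
Qed.

Section NextWalk.
Variable W : nat -> Omega -> V * nat.
Hypothesis mW : forall r x, measurable [set w | W r w = x].
Hypothesis walkW : forall k (x : nat -> V * nat),
  P [set w | history B t w /\ (forall r, (r <= k)%N -> W r w = x r)] =
  (P (history B t) * (srw_path_prob R e M k x)%:E)%E.

Lemma survival_le K :
  (Ps [set w | history B t w /\ forall i, (i <= K)%N -> ~ bd (W i w)] <=
   (fine (P (history B t)) * height_survival R d K M)%:E)%E.
Proof.
have := @walk_event_le R disp Omega P d V e regG (history B t) W M
  (measurable_history B t) mW walkW
  (fun j y => height_survival R d j y.2) (fun y => ~ cluster S y)
  (fun j tau => forall i, (i <= j)%N -> ~ bd (tau i)) pos_out
  (fun j y => height_survival_ge0 R d j y.2) _ _ V0 startM K.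
have -> : vertex_mean (fun v : V => height_survival R d K (v, M).2) =
          height_survival R d K M.
  rewrite /vertex_mean /= sumr_const -[#|xpredT|]/#|V| -[X in X / _]mulr_natr mulfK //.
  by rewrite pnatr_eq0 -lt0n.
apply.
- by move=> tau nS _; have := pos_out nS; case: (tau 0%N).2.
- move=> j tau nS Ev _; split => [|z tz|i ij].
  + by rewrite walk_op_height_survival // pos_out.
  + by apply: adj_out tz => //; exact: Ev.
  + exact: Ev.
Qed.

(** The Green function counts all visits to [x] before the walk enters the
    cluster, and the walk cannot enter without meeting the boundary before. *)
Lemma hit_le K x : bd x ->
  (Ps [set w | history B t w /\ exists i, [/\ (i <= K)%N, W i w = x &
                 forall j, (j < i)%N -> ~ bd (W j w)]] <=
   (fine (P (history B t)) *
    vertex_mean (fun v => green R d e (cluster S) x K (v, M)))%:E)%E.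
Proof.
move=> bdx.
apply: (@walk_event_le R disp Omega P d V e regG (history B t) W M
  (measurable_history B t) mW walkW
  (fun K => green R d e (cluster S) x K) (fun y => ~ cluster S y)
  (fun K tau => exists i, [/\ (i <= K)%N, tau i = x &
     forall j, (j < i)%N -> ~ bd (tau j)])) => //.
- by move=> j y; exact: green_ge0.
- move=> tau _ [i [+ tx _]]; rewrite leqn0 => /eqP i0.
  by move: tx; rewrite i0 => ->; exact: green_self.
- move=> j tau nS [[|i] [ij tx nb]] lt1.
    by move: lt1; rewrite tx ltNge green_self.
  split => [|z tz|].
  + by rewrite green_rec // lerDr.
  + by apply: adj_out tz => //; exact: nb.
  + by exists i; split => // j' j'i; exact: nb.
Qed.

End NextWalk.

(** Removes the event, of vanishing probability, that the walk has not yet met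
    the boundary at time [K]. *)
Lemma le_of_survival (a b : R) c :
  (forall K, a <= b + c * height_survival R d K M) -> a <= b.
Proof.
move=> H; have cv : (fun K => b + c * height_survival R d K M) @ \oo --> b + c * 0.
  apply: cvgD; first exact: cvg_cst.
  by apply: cvgMl_tmp; exact: height_survival_cvg0.
rewrite mulr0 addr0 in cv.
rewrite -(cvg_lim (@Rhausdorff R) cv).
apply: limr_ge; first by apply: (cvgP _ cv).
by near=> K; exact: H.
Unshelve. all: by end_near. Qed.

(** If [x] is the vertex added, then up to time [K] the walk either meets the
    boundary first at [x], or does not meet it at all. *)
Lemma step_prob_le x p : bd x ->
  (forall K, vertex_mean (fun v => green R d e (cluster S) x K (v, M)) <= p) ->
  fine (P (history (extend_history B t x) t.+1)) <= fine (P (history B t)) * p.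
Proof.
move=> bdx greenp; have [W [[mA mW] _ law grow]] := DLA.
have walkW := law t B M; rewrite BS in walkW.
apply: (@le_of_survival _ _ (fine (P (history B t)))) => K.
rewrite -lee_fin fineK ?fin_num_measure //; last exact: measurable_history.
rewrite EFinD -[leLHS](measurable_mu_extE P) //; last exact: measurable_history.
apply: (@le_trans _ _ (fine (P (history B t)) *
    vertex_mean (fun v => green R d e (cluster S) x K (v, M)) +
    fine (P (history B t)) * height_survival R d K M)%:E); last first.
  by rewrite EFinD leeD2r // lee_fin ler_wpM2l // fine_ge0.
rewrite EFinD; apply: le_trans (leeD (hit_le (mW t.+1) (walkW minM) K bdx)
  (survival_le (mW t.+1) (walkW minM) K)).
apply: le_trans (outer_measureU2 _ _ _); apply: le_outer_measure => w Hw.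
have Bw : history B t w.
  by move=> s st; have := Hw s (leqW st); rewrite /extend_history st.
have [surv|/existsNP [i0 /not_implyP [i0K /contrapT bdi0]]] :=
  pselect (forall i, (i <= K)%N -> ~ bd (W t.+1 i w)).
  by right.
left; split => //.
have [r [bdr minr]] : exists r, is_min [set r' | bd (W t.+1 r' w)] r.
  by apply: ex_is_min; exists i0.
exists r; split.
- by apply: leq_trans i0K; exact: minr.
- have At : A t w = cluster S by rewrite Bw.
  have := grow t w r; rewrite At => /(_ (conj bdr minr)).
  have := Hw t.+1 (leqnn _); rewrite /extend_history ltnn BS => -> /seteqP [H _].
  by have /H [|//] : (cluster S `|` [set x]) x by [right]; case: bdx.
- by move=> j jr bdj; have := minr _ bdj; rewrite leqNgt jr.
Qed.

(** The next cluster is prescribed only if the walk meets the boundary; it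
    fails to do so with probability zero. *)
Lemma step_cover :
  Ps (history B t `\` \bigcup_(x in bd) history (extend_history B t x) t.+1) = 0.
Proof.
have [W [[mA mW] _ law grow]] := DLA.
have walkW := law t B M; rewrite BS in walkW.
apply/eqP; rewrite eq_le outer_measure_ge0 andbT.
set E := (X in (Ps X <= _)%E).
have fE : (Ps E <= P (history B t))%E.
  rewrite -(measurable_mu_extE P); last exact: measurable_history.
  by apply: le_outer_measure => w [].
have finE : Ps E \is a fin_num.
  rewrite ge0_fin_numE ?outer_measure_ge0 //; apply: le_lt_trans fE _.
  by rewrite ltey_eq fin_num_measure //; exact: measurable_history.
rewrite -(fineK finE) lee_fin.
apply: (@le_of_survival _ _ (fine (P (history B t)))) => K.
rewrite add0r -lee_fin fineK //; apply: le_trans (survival_le (mW t.+1) (walkW minM) K).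
apply: le_outer_measure => w [Bw nU]; split => // i iK bdi; apply: nU.
have [r [bdr minr]] : exists r, is_min [set r' | bd (W t.+1 r' w)] r.
  by apply: ex_is_min; exists i.
exists (W t.+1 r w) => // s st1; rewrite /extend_history.
case: (leqP s t) => [st|ts].
  by rewrite Bw.
have -> : s = t.+1 by lia.
by rewrite -(Bw t) //; apply: grow; rewrite Bw // BS.
Qed.

End Step.
Definition reaches (a t r : nat) : set Omega :=
  [set w | exists2 r', (r' <= r)%N & exists2 x, A (t + r')%N w x & (a <= x.2)%N].

Section BackwardInduction.
Variables (a : nat) (beta : {fset V * nat} -> R).
Variable Phi : nat -> {fset V * nat} -> R.
Hypothesis a_gt0 : (0 < a)%N.
Hypothesis green_le_beta : forall S M x K,
  is_min [set i | layer i `&` cluster S = set0] M ->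
  cyl_boundary e (cluster S) x ->
  vertex_mean (fun v => green R d e (cluster S) x K (v, M)) <= beta S.
Hypothesis Phi_ge0 : forall r S, 0 <= Phi r S.
Hypothesis Phi_hit : forall r S x, x \in S -> (a <= x.2)%N -> 1 <= Phi r S.
Hypothesis Phi_step : forall r S (q : V * nat -> R),
  (forall x, x \in S -> (x.2 < a)%N) -> (forall x, 0 <= q x) ->
  (forall x, x \in bd_points e S -> q x <= beta S) ->
  \sum_(x <- bd_points e S) q x <= 1 ->
  \sum_(x <- bd_points e S) q x * Phi r (x |` S)%fset <= Phi r.+1 S.

Let Phist B t : R := fine (P (history B t)).

Let PhistE B t : P (history B t) = (Phist B t)%:E.
Proof. by rewrite /Phist fineK // fin_num_measure //; exact: measurable_history. Qed.

Let Phist_ge0 B t : 0 <= Phist B t. Proof. by rewrite fine_ge0. Qed.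

Let Ps_history B t : Ps (history B t) = (Phist B t)%:E.
Proof. by rewrite -PhistE; apply: measurable_mu_extE; exact: measurable_history. Qed.

(** A boundary vertex is not in the cluster, so different additions give
    different clusters and exclude one another. *)
Lemma sum_extend_history_le B t S : B t = cluster S ->
  \sum_(x <- bd_points e S) Phist (extend_history B t x) t.+1 <= Phist B t.
Proof.
move=> BS; rewrite -lee_fin -sumEFin -PhistE.
under eq_bigr do rewrite -PhistE.
apply: sum_disjoint_le.
- exact: undup_uniq.
- exact: measurable_history.
- by move=> x; exact: measurable_history.
- move=> x _ w Hw s st; have := Hw s (leqW st).
  by rewrite /extend_history st.
- move=> x y xb yb xy; apply/seteqP; split => // w [/(_ t.+1 (leqnn _)) Hx].
  move=> /(_ t.+1 (leqnn _)); rewrite Hx /extend_history ltnn BS.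
  move=> /seteqP [/(_ x) H _].
  have [nx _] := (mem_bd_points e S x).1 xb.
  have [|//|/= yx] := H; first by right.
  by move: xy; rewrite yx eqxx.
Qed.

(** Conditioning on the next vertex to be added reduces the statement for
    [r.+1] further steps to the one for [r] further steps. *)
Lemma reaches_le r t B S : B t = cluster S ->
  (Ps (history B t `&` reaches a t r) <= (Phist B t * Phi r S)%:E)%E.
Proof.
have [W [_ _ _ grow]] := DLA.
elim: r t B S => [|r IH] t B S BS.
all: have [[x [xS ax]]|nhit] := pselect (exists x, x \in S /\ (a <= x.2)%N).
- apply: (@le_trans _ _ (Ps (history B t))); first by apply: le_outer_measure => w [].
  by rewrite Ps_history lee_fin ler_peMr // (Phi_hit _ xS).
- rewrite (_ : _ `&` _ = set0) ?outer_measure0 ?lee_fin ?mulr_ge0 //.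
  apply/seteqP; split => // w [Hw [r' + [x]]].
  rewrite leqn0 => /eqP ->; rewrite addn0 Hw // BS => -[/= x0|/= xS] ax.
    by move: ax; rewrite leqNgt x0 a_gt0.
  by apply: nhit; exists x.
- apply: (@le_trans _ _ (Ps (history B t))); first by apply: le_outer_measure => w [].
  by rewrite Ps_history lee_fin ler_peMr // (Phi_hit _ xS).
have ltS x : x \in S -> (x.2 < a)%N.
  by move=> xS; rewrite ltnNge; apply/negP => ax; apply: nhit; exists x.
have [M minM] := ex_empty_layer S.
pose ext x := history (extend_history B t x) t.+1.
pose U := \bigcup_(x in cyl_boundary e (cluster S)) ext x.
have sub (s : seq (V * nat)) : (Ps (\bigcup_(x in [set` s]) (ext x `&` reaches a t.+1 r)) <=
    \sum_(x <- s) Ps (ext x `&` reaches a t.+1 r))%E.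
  elim: s => [|x s IHs].
    rewrite big_nil (_ : \bigcup_(_ in _) _ = set0) ?outer_measure0 //.
    by apply/seteqP; split => // w [].
  rewrite big_cons; apply: le_trans (leeD (le_refl _) IHs).
  apply: le_trans (outer_measureU2 _ _ _); apply: le_outer_measure => w [y /=].
  by rewrite inE => /orP[/eqP->|ys] Hw; [left|right; exists y].
apply: (@le_trans _ _ (Ps (history B t `\` U) +
    Ps (\bigcup_(x in [set` bd_points e S]) (ext x `&` reaches a t.+1 r)))%E).
  apply: le_trans (outer_measureU2 _ _ _).
  apply: le_outer_measure => w [Hw [r' r'r [x Ax ax]]].
  have [[y ybd wy]|nU] := pselect (U w); [right|by left].
  exists y; first exact/mem_bd_points.
  split => //; case: r' r'r Ax => [_|r' r'r Ax].
    rewrite addn0 Hw // BS => -[/= x0|/= xS].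
      by move: ax; rewrite leqNgt x0 a_gt0.
    by have := ltS x xS; rewrite ltnNge ax.
  by exists r' => //; exists x => //; rewrite addSnnS.
rewrite (step_cover BS minM) add0e; apply: le_trans (sub _) _.
apply: (@le_trans _ _ (\sum_(x <- bd_points e S)
    (Phist (extend_history B t x) t.+1 * Phi r (x |` S)%fset)%:E)%E).
  apply: lee_sum => x _; apply: IH.
  by rewrite /extend_history ltnn BS cluster_add.
rewrite sumEFin lee_fin.
(* if the history has positive probability, [Phi_step] is applied to the
   conditional probabilities of the next addition *)
have [h0|hpos] := eqVneq (Phist B t) 0.
  rewrite h0 mul0r big_seq big1 // => x xb.
  suff -> : Phist (extend_history B t x) t.+1 = 0 by rewrite mul0r.
  apply/eqP; rewrite eq_le Phist_ge0 andbT -h0.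
  apply: le_trans (sum_extend_history_le BS).
  rewrite (big_rem x) //= lerDl; apply: sumr_ge0 => y _; exact: Phist_ge0.
have hgt0 : 0 < Phist B t by rewrite lt0r hpos Phist_ge0.
rewrite -ler_pdivrMl // mulr_sumr.
under eq_bigr do rewrite mulrA.
apply: Phi_step => // [x|x xb|].
- by rewrite mulr_ge0 // invr_ge0.
- rewrite ler_pdivrMl //; apply: (step_prob_le BS minM).
    exact/mem_bd_points.
  by move=> K; apply: green_le_beta => //; exact/mem_bd_points.
- by rewrite -mulr_sumr ler_pdivrMl // mulr1; exact: sum_extend_history_le.
Qed.

End BackwardInduction.
End DLA.

(** * Probability of reaching a height *)

(** Markov's inequality.  Monotonicity is read off the definition of the
    integral of any nonnegative function as a supremum over the simple
    functions below it. *)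
Lemma ge0_integral_ge (R : realType) disp (Omega : measurableType disp)
    (P : probability Omega R) (f : Omega -> \bar R) (G : set Omega) (c : R) :
  measurable G -> 0 <= c -> (forall w, (0 <= f w)%E) ->
  (forall w, G w -> (c%:E <= f w)%E) ->
  (c%:E * P G <= \int[P]_w f w)%E.
Proof.
move=> mG c0 f0 Gf; rewrite -integral_cst // integral_mkcond.
rewrite !ge0_integralE //; last first.
  by move=> w _; rewrite patchE; case: ifP; rewrite ?lee_fin.
apply: ereal_sup_le => _ [h hle <-]; exists h => // w.
apply: le_trans (hle w) _; rewrite !patchE !in_setT.
by case: ifPn => // /set_mem; exact: Gf.
Qed.

Lemma sum_undup_le (R : realType) (T : eqType) (f : T -> R) (s : seq T) :
  (forall x, 0 <= f x) -> \sum_(x <- undup s) f x <= \sum_(x <- s) f x.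
Proof.
move=> f0; elim: s => [|x s IH] /=; first by rewrite !big_nil.
rewrite big_cons; case: ifP => _; last by rewrite big_cons lerD2l.
by apply: le_trans IH _; rewrite lerDr.
Qed.

Section BoundarySum.
Variables (R : realType) (d : nat) (V : finType) (e : rel V).
Hypothesis regG : regular_graph d e.

Lemma sum_bd_points_le (S : {fset V * nat}) (f : V * nat -> R)
    (g : V * nat -> R) :
  (forall x, 0 <= f x) ->
  (forall z x, z \in S -> x \in cyl_nbrs e z -> f x <= g z) ->
  \sum_(x <- bd_points e S) f x <=
  \sum_v f (v, 1%N) + d.+2%:R * \sum_(z <- enum_fset S) g z.
Proof.
move=> f0 fg; apply: le_trans (sum_undup_le _ f0) _.
rewrite big_filter big_mkcond.
apply: le_trans (_ : \sum_(x <- [seq (v, 1%N) | v <- enum V] ++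
     flatten [seq cyl_nbrs e z | z <- enum_fset S]) f x <= _).
  by apply: ler_sum => x _; case: ifP.
rewrite big_cat /= big_map big_enum /= lerD2l big_flatten big_map mulr_sumr.
rewrite !big_seq; apply: ler_sum => z zS.
apply: le_trans (_ : \sum_(x <- cyl_nbrs e z) g z <= _).
  by rewrite big_seq [leRHS]big_seq; apply: ler_sum => x; exact: fg.
rewrite big_const_seq count_predT iter_addr_0 /= size_map -cardE mulr_natl.
by rewrite -(regG z.1) cardsE.
Qed.

Lemma cyl_nbrs_height z x : x \in cyl_nbrs e z -> (x.2 <= z.2.+1)%N.
Proof.
rewrite !inE => /or3P[/eqP->|/eqP->|/mapP[v _ ->]] //=; lia.
Qed.

End BoundarySum.

Section Reach.
Context (R : realType) (disp : measure_display) (Omega : measurableType disp).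
Variables (P : probability Omega R) (d : nat) (V : finType) (e : rel V).
Hypothesis simpleG : simple_graph e.
Hypothesis regG : regular_graph d e.
Hypothesis V0 : (0 < #|V|)%N.
Local Notation Ps := (mu_ext P).
Local Notation D := (d.+2%:R : R).
Variable A : nat -> Omega -> set (V * nat).
Hypothesis DLA : cylinder_DLA P e A.

Let history0 : history A (fun=> layer 0) 0 = setT.
Proof.
have [W [_ A0 _ _]] := DLA.
by apply/seteqP; split => // w _ s; rewrite leqn0 => /eqP ->; rewrite A0.
Qed.

Let cluster0 : layer 0 = cluster (fset0 : {fset V * nat}).
Proof.
by rewrite /cluster; apply/seteqP; split => x; [left|case].
Qed.

(** The weight of a cluster: [S] lists its vertices outside layer zero, and
    each of the [#|V|] vertices of layer zero has weight [1]. *)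
Definition mass (theta : R) (S : {fset V * nat}) : R :=
  #|V|%:R + \sum_(x <- enum_fset S) theta ^+ x.2.

Lemma mass_add theta (S : {fset V * nat}) x : x \notin S ->
  mass theta (x |` S)%fset = mass theta S + theta ^+ x.2.
Proof.
move=> xS; rewrite /mass; have -> /= := @big_fsetU1 R 0 +%R _ x S (fun y => theta ^+ y.2) xS.
by rewrite addrCA addrC.
Qed.

(** Every boundary vertex is a neighbour of some vertex of the cluster and at
    most one layer higher; a vertex has at most [D] neighbours. *)
Lemma sum_bd_points_mass theta (S : {fset V * nat}) : 1 <= theta ->
  \sum_(x <- bd_points e S) theta ^+ x.2 <= theta * D * mass theta S.
Proof.
move=> th1; have th0 : 0 <= theta by apply: le_trans th1.
apply: le_trans (sum_bd_points_le regG (g := fun z => theta * theta ^+ z.2) _ _) _.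
- by move=> x; rewrite exprn_ge0.
- move=> z x _ /cyl_nbrs_height xz; rewrite -exprS.
  by apply: ler_weXn2l.
rewrite -mulr_sumr sumr_const /= -[X in X + _]mulr_natr -[#|_|]/#|V| /mass mulrDr.
rewrite mulrCA mulrA lerD2r [leRHS]mulrAC ler_peMr ?mulr_ge0 //.
by rewrite (ler_nat R 1).
Qed.

(** By [sum_bd_points_mass] one step multiplies the expected mass by at most
    [1 + p * (theta * D)], and a cluster with a vertex of height [a] has mass at
    least [theta ^+ a]. *)
Lemma reach_prob_le_mass (p : R) (theta : R) a r :
  (0 < a)%N -> 1 <= theta -> 0 <= p ->
  (forall S M x K, is_min [set i | layer i `&` cluster S = set0] M ->
     cyl_boundary e (cluster S) x ->
     vertex_mean (fun v => green R d e (cluster S) x K (v, M)) <= p) ->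
  (Ps (reaches A a 0 r) <=
     (theta ^- a * (1 + p * (theta * D)) ^+ r * #|V|%:R)%:E)%E.
Proof.
move=> a0 th1 p0 green_le_p.
have th0 : 0 < theta by apply: lt_le_trans th1.
have c0 : 0 <= 1 + p * (theta * D) by rewrite addr_ge0 // !mulr_ge0 // ltW.
have mass0 S : 0 <= mass theta S.
  by rewrite addr_ge0 // sumr_ge0 // => x _; rewrite exprn_ge0 // ltW.
pose Phi r S := theta ^- a * (1 + p * (theta * D)) ^+ r * mass theta S.
have := @reaches_le R disp Omega P d V e simpleG regG V0 A DLA a (fun=> p) Phi
  a0 green_le_p _ _ _ r 0 (fun=> layer 0) fset0 cluster0.
rewrite history0 setTI probability_setT mul1r /Phi /mass big_nil addr0.
apply => {r}.
- move=> r S; apply: mulr_ge0 (mass0 S); apply: mulr_ge0; last exact: exprn_ge0.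
  by rewrite invr_ge0 exprn_ge0 // ltW.
- move=> r S x xS ax.
  apply: le_trans (_ : theta ^- a * theta ^+ x.2 <= _).
    rewrite mulrC ler_pdivlMr ?exprn_gt0 // mul1r.
    by apply: ler_weXn2l.
  rewrite -mulrA ler_wpM2l ?invr_ge0 ?exprn_ge0 ?(ltW th0) //.
  apply: le_trans (_ : mass theta S <= _).
    rewrite /mass (big_rem x) //= addrCA lerDl addr_ge0 //.
    by apply: sumr_ge0 => y _; rewrite exprn_ge0 // ltW.
  rewrite ler_peMl // exprn_ege1 // lerDl !mulr_ge0 //; exact: ltW.
- move=> r S q _ q0 qp q1.
  apply: le_trans (_ : theta ^- a * (1 + p * (theta * D)) ^+ r *
    ((1 + p * (theta * D)) * mass theta S) <= _); last first.
    by rewrite exprS -/(mass theta S) !mulrA [X in X * mass theta S <= _]mulrAC -!mulrA.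
  under eq_bigr do rewrite mulrCA.
  rewrite -mulr_sumr ler_wpM2l //.
    by rewrite mulr_ge0 ?exprn_ge0 // invr_ge0 exprn_ge0 // ltW.
  apply: le_trans (_ : \sum_(x <- bd_points e S) (q x * mass theta S + p * theta ^+ x.2) <= _).
    rewrite !big_seq; apply: ler_sum => x xb.
    have xS : x \notin S.
      apply/negP => xS; have [nx _] := (mem_bd_points e S x).1 xb.
      by apply: nx; right.
    rewrite -/(mass theta (x |` S)%fset) mass_add // mulrDr lerD2l.
    by rewrite ler_wpM2r ?exprn_ge0 ?(ltW th0) // qp.
  rewrite big_split /= -mulr_suml -mulr_sumr mulrDl mul1r -mulrA.
  rewrite lerD //; first by rewrite ler_piMl.
  by rewrite ler_wpM2l // sum_bd_points_mass.
Qed.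

(** Before height two is reached, the first empty layer is at most layer two.
    After [i] steps, at most [D * i] boundary vertices have height two or more,
    since these are attached to the [i] vertices already added. *)
Lemma reach_prob_le_low (p : R) r : 0 <= p ->
  (forall S M x K, (M <= 2)%N ->
     is_min [set i | layer i `&` cluster S = set0] M ->
     cyl_boundary e (cluster S) x ->
     vertex_mean (fun v => green R d e (cluster S) x K (v, M)) <= p) ->
  (Ps (reaches A 2 0 r) <= (D * p * r%:R ^+ 2)%:E)%E.
Proof.
move=> p0 green_le_p.
pose high (S : {fset V * nat}) := has (fun x : V * nat => 2 <= x.2)%N (enum_fset S).
pose beta S : R := if high S then D else p.
pose Phi r S : R :=
  (high S)%:R + D * p * \sum_(i < r) (#|` S| + i)%:R.
have Dp0 : 0 <= D * p by rewrite mulr_ge0.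
have sum0 r' S : 0 <= D * p * \sum_(i < r') (#|` S| + i)%:R.
  by rewrite mulr_ge0 // sumr_ge0.
have green_le_beta S M x K : is_min [set i | layer i `&` cluster S = set0] M ->
    cyl_boundary e (cluster S) x ->
    vertex_mean (fun v => green R d e (cluster S) x K (v, M)) <= beta S.
  move=> minM bdx; rewrite /beta; case: ifPn => [_|/hasPn lowS].
    rewrite /vertex_mean ler_pdivrMr ?ltr0n // mulr_natr -sumr_const.
    by apply: ler_sum => v _; exact: green_le.
  apply: green_le_p => //; apply: minM.2.
  apply/seteqP; split => // y [/= y2] [|/= /lowS].
    by rewrite /layer /= (y2 : y.2 = 2).
  by rewrite (y2 : y.2 = 2).
have := @reaches_le R disp Omega P d V e simpleG regG V0 A DLA 2 beta Phi
  isT green_le_beta _ _ _ r 0 (fun=> layer 0) fset0 cluster0.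
rewrite history0 setTI probability_setT mul1r.
have -> : Phi r fset0 = D * p * \sum_(i < r) i%:R.
  rewrite /Phi /high /= mulr0n add0r.
  by under eq_bigr do rewrite add0n.
move=> H; apply: le_trans (H _ _ _) _ => {H}.
- by move=> r' S; rewrite addr_ge0.
- move=> r' S x xS x2; rewrite /Phi (_ : high S) ?lerDl //.
  by apply/hasP; exists x.
- move=> r' S q lowS q0; rewrite /beta /Phi.
  have -> : high S = false by apply/hasPn => x /lowS; rewrite -leqNgt.
  move=> qp q1; rewrite mulr0n add0r big_ord_recl addn0 mulrDr.
  have -> : \sum_(i < r') (#|` S| + lift ord0 i)%:R =
      \sum_(i < r') (#|` S|.+1 + i)%:R :> R.
    by apply: eq_bigr => i _; rewrite /= /bump /= addnCA addSn.
  have -> : \sum_(x <- bd_points e S) q x *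
      ((high (x |` S)%fset)%:R + D * p * \sum_(i < r') (#|` (x |` S)%fset| + i)%:R) =
    \sum_(x <- bd_points e S) q x * (2 <= x.2)%N%:R +
    (\sum_(x <- bd_points e S) q x) *
      (D * p * \sum_(i < r') (#|` S|.+1 + i)%:R).
    rewrite mulr_suml -big_split /= big_seq [RHS]big_seq; apply: eq_bigr => x xb.
    have xS : x \notin S.
      apply/negP => xS; have [nx _] := (mem_bd_points e S x).1 xb.
      by apply: nx; right.
    rewrite -mulrDr cardfsU1 xS add1n; congr (_ * (_%:R + _)).
    congr nat_of_bool; apply/hasP/idP => [[y]|x2]; last first.
      by exists x => //; rewrite in_fset1U eqxx.
    by rewrite in_fset1U => /orP[/eqP->//|/lowS]; rewrite ltnNge => /negPf->.
  apply: lerD; last by rewrite ler_piMl // mulr_ge0 // sumr_ge0.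
  apply: le_trans (_ : \sum_(x <- bd_points e S) p * (2 <= x.2)%N%:R <= _).
    by rewrite !big_seq; apply: ler_sum => x xb; rewrite ler_wpM2r // qp.
  rewrite [X in _ <= X * _]mulrC -mulrA -mulr_sumr ler_wpM2l //.
  apply: le_trans (sum_bd_points_le regG (g := fun=> 1) _ _) _ => //.
    by move=> z x _ _; case: leqP.
  by rewrite big1 // add0r big_const_seq count_predT iter_addr_0.
- rewrite lee_fin ler_wpM2l //.
  apply: le_trans (_ : \sum_(i < r) r%:R <= _).
    by apply: ler_sum => i _; rewrite ler_nat ltnW.
  by rewrite sumr_const card_ord expr2 mulr_natr.
Qed.

(** A lower height [a] may stand in for [m], since a cluster that meets layer
    [m] has a vertex of height at least [a]. *)
Lemma reach_time_ge (a m k : nat) : (a <= m)%N ->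
  (Ps (reaches A a 0 k) <= (2^-1)%:E)%E ->
  ((k.+1%:R / 2)%:E <= \int[P]_w reach_time R A m w)%E.
Proof.
move=> am small; have [W [[mA _] _ _ _]] := DLA.
pose G := [set w | forall r, (r <= k)%N -> forall v, ~ A r w (v, m)].
have mG : measurable G.
  have -> : G = \bigcap_(r in [set r | (r <= k)%N])
      \bigcap_(v in [set: V]) ~` [set w | A r w (v, m)].
    by apply/seteqP; split => w Gw r rk v => [_|]; [exact: Gw|exact: (Gw r rk v I)].
  apply: bigcap_measurable => [|r _]; first by exists 0%N.
  by apply: fin_bigcap_measurable => // v _; apply: measurableC; exact: mA.
have PG : ((2^-1)%:E <= P G)%E.
  have : (P (~` G) <= (2^-1)%:E)%E.
    rewrite -(measurable_mu_extE P); last exact: measurableC.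
    apply: le_trans small; apply: le_outer_measure => w /existsNP [r].
    move=> /not_implyP [rk /existsNP [v /contrapT Av]].
    by exists r => //; exists (v, m).
  rewrite probability_setC // -(fineK (fin_num_measure P _ mG)) -EFinB !lee_fin.
  by move=> ?; lra.
apply: (@le_trans _ _ (k.+1%:R%:E * P G)%E).
  rewrite EFinM -(fineK (fin_num_measure P _ mG)) -EFinM lee_fin ler_wpM2l //.
  by rewrite -lee_fin fineK // fin_num_measure.
apply: ge0_integral_ge => // w => [|Gw]; apply: le_ereal_inf_tmp => y [t].
  by move=> _ <-; rewrite lee_fin.
move=> [[v j] [Av /= jm]] <-.
rewrite lee_fin ler_nat ltnNge; apply/negP => tk; apply: (Gw t tk v).
by rewrite -jm.
Qed.

End Reach.

(** * Choice of the constants *)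

Lemma nonempty_lower_layers (V : finType) (S : {fset V * nat}) M i :
  is_min [set i | layer i `&` cluster S = set0] M -> (i < M)%N ->
  exists v, cluster S (v, i).
Proof.
move=> [_ minM] iM; apply: contrapT => /forallNP none.
have /minM : [set i | layer i `&` cluster S = set0] i.
  apply/seteqP; split => // -[v j] [/= ji Sv]; apply: (none v).
  by rewrite -(ji : j = i).
by rewrite leqNgt iM.
Qed.

(** The choice [c = s ^- 17] balances the two terms of [green_layer_mean_le]:
    [c / gap] is at most [s ^- 3] and [c^-1 / n] equals [s ^- 3]. *)
Lemma hit_bound (R : realType) (d : nat) (V : finType) (e : rel V)
    (lambda : seq R) (s p : R) :
  (0 < d)%N -> simple_graph e -> connected_graph e -> regular_graph d e ->
  spectrum (transition_matrix R d e) lambda ->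
  #|V|%:R = s ^+ 20 -> 1 <= s -> s ^- 14 <= spectral_gap lambda ->
  0 <= p -> 3 * d.+2%:R ^+ 2 <= p ^+ 2 * s ^+ 3 ->
  forall S M x K, is_min [set i | layer i `&` cluster S = set0] M ->
     cyl_boundary e (cluster S) x ->
     vertex_mean (fun v => green R d e (cluster S) x K (v, M)) <= p.
Proof.
move=> d0 simpleG conG regG specG nE s1 gaps p0 pbig S M x K minM bdx.
have s0 : 0 < s by apply: lt_le_trans s1.
have gap0 : 0 < spectral_gap lambda.
  by apply: lt_le_trans gaps; rewrite invr_gt0 exprn_gt0.
have V0 : (0 < #|V|)%N by rewrite -(ltr0n R) nE exprn_gt0.
have c0 : 0 < s ^- 17 by rewrite invr_gt0 exprn_gt0.
have := green_layer_mean_le simpleG regG d0 (@subsetUl _ _ _) bdx V0 conG specG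
  gap0 (fun i => @nonempty_lower_layers _ _ _ i minM) K c0.
rewrite /= nE => H.
rewrite -(ler_pXn2r (ltn0Sn 1)) ?nnegrE //; last first.
  by rewrite divr_ge0 // sumr_ge0 // => v _; exact: green_ge0.
apply: le_trans H _.
have cgap : s ^- 17 / spectral_gap lambda <= s ^- 3.
  rewrite ler_pdivrMr // -ler_pdivrMl ?invr_gt0 ?exprn_gt0 //.
  apply: le_trans gaps; rewrite invrK (_ : s ^+ 3 / s ^+ 17 = s ^- 14) //.
  by field; rewrite gt_eqF.
rewrite invrK.
have cn : (1 + s ^+ 17) / s ^+ 20 <= 2 * s ^- 3.
  rewrite ler_pdivrMr ?exprn_gt0 // -mulrA (_ : s ^- 3 * s ^+ 20 = s ^+ 17); last first.
    by rewrite (exprD s 3 17) mulKf // expf_neq0 // gt_eqF.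
  by have := exprn_ege1 17 s1; lra.
apply: le_trans (_ : d.+2%:R ^+ 2 * (3 * s ^- 3) <= _).
  rewrite ler_wpM2l ?sqr_ge0 //; lra.
by rewrite mulrA ler_pdivrMr ?exprn_gt0 // mulrC.
Qed.

Lemma hit_bound_low (R : realType) (d : nat) (V : finType) (e : rel V)
    (lambda : seq R) (p : R) :
  (0 < d)%N -> simple_graph e -> connected_graph e -> regular_graph d e ->
  spectrum (transition_matrix R d e) lambda -> 0 < spectral_gap lambda ->
  (0 < #|V|)%N ->
  0 <= p -> 2 * d.+2%:R ^+ 2 <= p ^+ 2 * #|V|%:R ->
  forall S M x K, (M <= 2)%N ->
     is_min [set i | layer i `&` cluster S = set0] M ->
     cyl_boundary e (cluster S) x ->
     vertex_mean (fun v => green R d e (cluster S) x K (v, M)) <= p.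
Proof.
move=> d0 simpleG conG regG specG gap0 V0 p0 pbig S M x K M2 minM bdx.
have := green_layer_mean_le_low simpleG regG d0 (@subsetUl _ _ _) bdx V0 conG specG
  gap0 (fun i => @nonempty_lower_layers _ _ _ i minM) K M2.
rewrite /= => H.
rewrite -(ler_pXn2r (ltn0Sn 1)) ?nnegrE //; last first.
  by rewrite divr_ge0 // sumr_ge0 // => v _; exact: green_ge0.
by apply: le_trans H _; rewrite ler_pdivrMr // ltr0n.
Qed.

(** It suffices that [expR y >= (1 + y / 11) ^+ 11], as [(s ^+ 2) ^+ 11] is
    already larger than [2 * s ^+ 20]. *)
Lemma exp_tail (R : realType) (s x : R) : 22 <= s -> s ^+ 3 <= x ->
  2 * s ^+ 20 <= expR (x / 2).
Proof.
move=> s22 sx; have s0 : 0 <= s by lra.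
have x0 : 0 <= x by apply: le_trans sx; rewrite exprn_ge0.
have -> : x / 2 = (x / 22) * 11%:R by field.
rewrite expRM_natr.
apply: le_trans (_ : (s ^+ 2) ^+ 11 <= _); last first.
  apply: lerXn2r; rewrite ?nnegrE ?exprn_ge0 ?expR_ge0 //.
  apply: le_trans (expR_ge1Dx _).
  have : s ^+ 2 <= x / 22.
    rewrite ler_pdivlMr //; apply: le_trans sx.
    by rewrite [leRHS]exprSr ler_wpM2l ?exprn_ge0.
  lra.
rewrite -exprM (exprD s 2 20) ler_wpM2r ?exprn_ge0 //.
by rewrite expr2; nra.
Qed.

Lemma sqr_inv_mul_le (R : realType) (E t : R) :
  0 < E -> 2 * t <= E -> (E ^+ 2)^-1 * E * t <= 2^-1.
Proof.
move=> E0 tE; rewrite expr2 invfM mulrVK ?unitfE ?gt_eqF // mulrC.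
by rewrite ler_pdivrMr //; lra.
Qed.

Theorem theorem5p1 (R : realType) (d : nat) (hd : (2 <= d)%N) :
  exists (n0 : nat) (C : R), 0 < C /\
  forall n : nat, (n0 < n)%N ->
  forall (V : finType) (e : rel V),
    simple_graph e -> connected_graph e -> regular_graph d e -> #|V| = n ->
  forall lambda : seq R,
    spectrum (transition_matrix R d e) lambda ->
    n%:R `^ (- (2 / 3)) <= spectral_gap lambda ->
  forall (disp : measure_display) (Omega : measurableType disp)
         (P : probability Omega R) (A : nat -> Omega -> set (V * nat)),
    cylinder_DLA P e A ->
  forall m : nat, (2 <= m)%N ->
    ((C * m%:R * n%:R `^ (1 / 20))%:E < \int[P]_w reach_time R A m w)%E.
Proof.
pose D : R := d.+2%:R; pose e1 : R := expR 1.
have e1_ge1 : 1 <= e1 by rewrite -[leLHS]expR0 ler_expR.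
have D_ge1 : 1 <= D by rewrite (ler_nat R 1).
have [S0 [S0_ge22 S0_geD S0_big]] : exists S0 : R,
    [/\ 22 <= S0, 2 * D <= S0 & 12 * e1 ^+ 2 * D ^+ 4 <= S0].
  exists (12 * e1 ^+ 2 * D ^+ 4 + 22); split; last by rewrite lerDl.
    by rewrite lerDr !mulr_ge0 ?exprn_ge0 //; lra.
  have : 1 * D <= (e1 ^+ 2 * D ^+ 3) * D.
    by rewrite ler_wpM2r ?ler0n // mulr_ege1 ?exprn_ege1.
  by rewrite -mulrA; nra.
exists (Num.truncn (S0 ^+ 20)), (1 / 2); split; first by lra.
move=> n n0n V e simpleG conG regG Vn lambda specG gapn disp Omega P A DLA m m2.
have n_ge : S0 ^+ 20 < n%:R.
  by rewrite -truncn_lt_nat // exprn_ge0 //; lra.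
set s : R := n%:R `^ (1 / 20).
have n_gt0 : 0 < n%:R :> R by apply: le_lt_trans n_ge; rewrite exprn_ge0 //; lra.
have ns : n%:R = s ^+ 20.
  rewrite -powR_mulrn ?powR_ge0 // -powRrM (_ : 1 / 20 * 20%:R = 1) ?powRr1 //.
  by field.
have s_geS : S0 <= s.
  rewrite leNgt; apply/negP => sS; move: n_ge; rewrite ns ltNge => /negP; apply.
  by rewrite lerXn2r ?nnegrE ?powR_ge0 // ltW //; lra.
have {n_ge} s22 : 22 <= s by apply: le_trans s_geS.
have s1 : 1 <= s by lra.
have s0 : 0 < s by lra.
have gaps : s ^- 14 <= spectral_gap lambda.
  apply: le_trans gapn.
  have -> : s ^- 14 = n%:R `^ (- (14 / 20)).
    rewrite powRN -powR_mulrn ?powR_ge0 // -powRrM; congr (_ `^ _)^-1; by field.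
  apply: ler_powR; last by lra.
  by rewrite ns exprn_ege1.
have d0 : (0 < d)%N by apply: leq_trans hd.
have V0 : (0 < #|V|)%N by rewrite Vn -(ltr0n R).
set x := m%:R * s; pose k := Num.truncn x.
have x0 : 0 <= x by rewrite mulr_ge0 // ltW.
have kx : k%:R <= x by have /andP[] := truncn_itv x0.
have xk : x < k.+1%:R by exact: truncnS_gt.
(* [a = 2] for low [m], [a = m] otherwise *)
suff [a am small] : exists2 a, (a <= m)%N & (mu_ext P (reaches A a 0 k) <= (2^-1)%:E)%E.
  apply: lt_le_trans (reach_time_ge DLA am small).
  rewrite lte_fin -[1 / 2 * _ * _]mulrA -/x; lra.
have [ms|sm] := leP m%:R (s ^+ 3).
  exists 2%N => //; pose p := 2 * D / s ^+ 10.
  have p0 : 0 <= p by rewrite divr_ge0 ?exprn_ge0 // ?mulr_ge0 //; lra.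
  have gap0 : 0 < spectral_gap lambda.
    by apply: lt_le_trans gaps; rewrite invr_gt0 exprn_gt0.
  have bnd : 2 * d.+2%:R ^+ 2 <= p ^+ 2 * #|V|%:R.
    rewrite Vn ns /p -/D expr_div_n -exprM divfK; last by rewrite expf_neq0 // gt_eqF.
    by have := sqr_ge0 D; rewrite exprMn; nra.
  have low := hit_bound_low d0 simpleG conG regG specG gap0 V0 p0 bnd.
  apply: le_trans (reach_prob_le_low simpleG regG V0 DLA k p0 low) _.
  rewrite lee_fin -/D.
  have ks : k%:R <= s ^+ 4.
    by apply: le_trans kx _; rewrite exprSr ler_wpM2r // ltW.
  apply: le_trans (_ : D * p * (s ^+ 4) ^+ 2 <= _).
    apply: ler_wpM2l; first by apply: mulr_ge0 p0; lra.
    by apply: lerXn2r; rewrite ?nnegrE ?exprn_ge0 // ltW.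
  have -> : D * p * (s ^+ 4) ^+ 2 = 2 * D ^+ 2 / s ^+ 2.
    by rewrite /p; field; rewrite gt_eqF.
  rewrite ler_pdivrMr ?exprn_gt0 //.
  by have : 2 * D <= s by [apply: le_trans s_geS]; nra.
(* [p * (e1 * D)] is then [1 / (2 * s)], and [k <= m * s] *)
exists m => //; pose p := (2 * e1 * D * s)^-1.
have den0 : 0 < 2 * e1 * D * s by rewrite !mulr_gt0 //; lra.
have p0 : 0 <= p by rewrite invr_ge0 ltW.
have bnd : 3 * d.+2%:R ^+ 2 <= p ^+ 2 * s ^+ 3.
  have -> : p ^+ 2 * s ^+ 3 = s / (4 * e1 ^+ 2 * D ^+ 2).
    by rewrite /p; field; rewrite ?gt_eqF //; lra.
  have den1 : 0 < 4 * e1 ^+ 2 * D ^+ 2 by rewrite !mulr_gt0 ?exprn_gt0 //; lra.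
  by rewrite ler_pdivlMr // -/D; lra.
have m0 : (0 < m)%N by apply: leq_trans m2.
have VR : #|V|%:R = s ^+ 20 by rewrite Vn.
have hit := hit_bound d0 simpleG conG regG specG VR s1 gaps p0 bnd.
apply: le_trans (reach_prob_le_mass simpleG regG V0 DLA k m0 e1_ge1 p0 hit) _.
rewrite lee_fin -/D Vn ns.
have -> : p * (e1 * D) = (2 * s)^-1.
  by rewrite /p; field; rewrite ?gt_eqF //; lra.
have growth : (1 + (2 * s)^-1) ^+ k <= expR (m%:R / 2).
  apply: le_trans (_ : expR (2 * s)^-1 ^+ k <= _).
    apply: lerXn2r; rewrite ?nnegrE ?expR_ge0 ?expR_ge1Dx //.
    by rewrite addr_ge0 // invr_ge0 mulr_ge0 // ltW.
  rewrite -expRM_natr ler_expR -mulr_natr ler_pdivrMl; last by rewrite mulr_gt0.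
  by apply: le_trans kx _; rewrite /x; lra.
have e1m : e1 ^+ m = expR (m%:R / 2) ^+ 2.
  by rewrite /e1 -!expRM_natr -mulr_natr; congr expR; field.
have tail := exp_tail s22 (ltW sm).
apply: le_trans (sqr_inv_mul_le (expR_gt0 (m%:R / 2)) tail).
rewrite -e1m; apply: ler_wpM2r; first by apply: exprn_ge0; exact: ltW.
apply: ler_wpM2l growth; rewrite invr_ge0; apply: exprn_ge0.
exact: le_trans ler01 e1_ge1.
Qed.
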